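(* Let $\Lambda=\Lambda_{(\phi,\psi)}=\begin{pmatrix} A & {}_AN_B \\ {}_BM_A & B\end{pmatrix}$ be a Morita ring, and let $(\mathcal{U},\mathcal{X})$ and $(\mathcal{V},\mathcal{Y})$ be cotorsion pairs in $A\text{-}\mathrm{Mod}$ and $B\text{-}\mathrm{Mod}$, respectively. Assume that $M\otimes_AN=0$. Define the following classes of left $\Lambda$-modules: $$\mathcal{M}^{\mathcal{V}}_{\mathcal{U}}=\Big\{\begin{pmatrix} X \\ Y \end{pmatrix}_{f,g}\ \Big|\ \operatorname{Coker} f\in\mathcal{V},\ X\in\mathcal{U},\ f\text{ is a monomorphism}\Big\},$$ $$\mathcal{N}^{\mathcal{Y}}_{\mathcal{X}}=\Big\{\begin{pmatrix} X \\ Y \end{pmatrix}_{f,g}\ \Big|\ \operatorname{Ker}\tilde g\in\mathcal{Y},\ X\in\mathcal{X},\ \tilde g\text{ is an epimorphism}\Big\}.$$ (1) If $\operatorname{Tor}^A_1(M,\mathcal{U})=0$, then $({}^\perp\mathcal{N}^{\mathcal{Y}}_{\mathcal{X}},\mathcal{N}^{\mathcal{Y}}_{\mathcal{X}})$ is a cotorsion pair in $\Lambda\text{-}\mathrm{Mod}$; if $\operatorname{Ext}_A^1(N,\mathcal{X})=0$, then $(\mathcal{M}^{\mathcal{V}}_{\mathcal{U}},(\mathcal{M}^{\mathcal{V}}_{\mathcal{U}})^\perp)$ is a cotorsion pair in $\Lambda\text{-}\mathrm{Mod}$. (2) If $\operatorname{Tor}^A_1(M,\mathcal{U})=0$ and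 $\operatorname{Ext}_A^1(N,\mathcal{X})=0$, then $(\mathcal{M}^{\mathcal{V}}_{\mathcal{U}},\mathcal{N}^{\mathcal{Y}}_{\mathcal{X}})$ is a cotorsion pair in $\Lambda\text{-}\mathrm{Mod}$; and it is complete and hereditary if so are $(\mathcal{U},\mathcal{X})$ and $(\mathcal{V},\mathcal{Y})$.
   Context: Morita rings. Let $A,B$ be rings, ${}_BM_A$ and ${}_AN_B$ bimodules, $\phi:M\otimes_AN\to B$ a $B$-bimodule map and $\psi:N\otimes_BM\to A$ an $A$-bimodule map such that $m'\psi(n\otimes m)=\phi(m'\otimes n)m$ and $n'\phi(m\otimes n)=\psi(n'\otimes m)n$ for all $m,m'\in M$, $n,n'\in N$. The Morita ring $\Lambda_{(\phi,\psi)}=\begin{pmatrix} A & N \\ M & B \end{pmatrix}$ has componentwise addition and multiplication $\begin{pmatrix} a & n \\ m & b \end{pmatrix}\begin{pmatrix} a' & n' \\ m' & b' \end{pmatrix}=\begin{pmatrix} aa'+\psi(n\otimes m') & an'+nb' \\ ma'+bm' & \phi(m\otimes n')+bb' \end{pmatrix}$. Left $\Lambda$-modules are identified with quadruples $\begin{pmatrix} X \\ Y \end{pmatrix}_{f,g}$, where $X\in A\text{-}\mathrm{Mod}$, $Y\in B\text{-}\mathrm{Mod}$, $f\in\operatorname{Hom}_B(M\otimes_AX,Y)$, $g\in\operatorname{Hom}_A(N\otimes_BY,X)$ satisfy $g(n\otimes f(m\otimes x))=\psi(n\otimes m)x$ and $f(m\otimes g(n\otimes y))=\phi(m\otimes n)y$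 for all $m\in M,n\in N,x\in X,y\in Y$; homomorphisms are pairs $(a,b)$ of an $A$-map and a $B$-map compatible with the $f$'s and $g$'s. $\tilde f:X\to\operatorname{Hom}_B(M,Y)$ and $\tilde g:Y\to\operatorname{Hom}_A(N,X)$ denote the maps corresponding to $f$ and $g$ under the tensor-Hom adjunctions. All classes of modules are closed under isomorphisms; $\operatorname{Tor}_1^A(M,\mathcal{C})=0$ means vanishing on every object of $\mathcal{C}$, and similarly for $\operatorname{Ext}$. Cotorsion pairs. For a class $\mathcal{C}$ of modules, $\mathcal{C}^\perp=\{X\mid\operatorname{Ext}^1(C,X)=0\ \forall C\in\mathcal{C}\}$ and ${}^\perp\mathcal{C}=\{X\mid\operatorname{Ext}^1(X,C)=0\ \forall C\in\mathcal{C}\}$. $(\mathcal{C},\mathcal{D})$ is a cotorsion pair if $\mathcal{C}^\perp=\mathcal{D}$ and ${}^\perp\mathcal{D}=\mathcal{C}$. It is complete if for each module $Z$ there are short exact sequences $0\to D_1\to C_1\to Z\to0$ and $0\to Z\to D_2\to C_2\to0$ with $C_i\in\mathcal{C}$, $D_i\in\mathcal{D}$. It is hereditary if $\mathcal{C}$ is closed under kernels of epimorphisms and $\mathcal{D}$ is closed under cokernels of monomorphisms. *)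

(* Defs.v *)
From HB Require Import structures.
From mathcomp Require Import all_boot ssralg ssrint ring_quotient boolp freeg.

Set Implicit Arguments.
Unset Strict Implicit.
Unset Printing Implicit Defensive.

Import GRing.Theory.
Import Quotient.Exports.
Local Open Scope ring_scope.
Local Open Scope quotient_scope.

HB.mixin Record Lmodule_isBimodule (B A : pzRingType) M of GRing.Lmodule B M := {
  ract : M -> A -> M;
  ractDl : forall a, {morph ract^~ a : m m' / m + m'};
  ractDr : forall m, {morph ract m : a a' / a + a'};
  ractA : forall m a a', ract m (a * a') = ract (ract m a) a';
  ract1 : forall m, ract m 1 = m;
  ractZl : forall b m a, ract (b *: m) a = b *: ract m a
}.

(* [bimodType B A] : bimodules with [B] acting on the left and [A] on the
   right, the right action being [ract m a]. *)
#[short(type="bimodType")]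
HB.structure Definition Bimodule (B A : pzRingType) :=
  {M of GRing.Lmodule B M & Lmodule_isBimodule B A M}.

Section Linear.
Context (R : pzRingType) (U V : lmodType R).
Implicit Types h : {linear U -> V}.

Definition kernel_pred h : {pred U} := [pred u | h u == 0].

Lemma kernel_submod_closed h : submod_closed (kernel_pred h).
Proof.
split=> [|a u v]; rewrite !inE ?linear0 //.
by move=> /eqP hu /eqP hv; rewrite linearP hu hv scaler0 addr0.
Qed.
HB.instance Definition _ h :=
  GRing.isSubmodClosed.Build R U (kernel_pred h) (kernel_submod_closed h).

Definition Ker h : Type := {u : U | kernel_pred h u}.
HB.instance Definition _ h := SubChoice.on (Ker h).
HB.instance Definition _ h := [SubChoice_isSubLmodule of Ker h by <:].

Definition image_pred h : {pred V} := fun v => `[< exists u, h u = v >].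

Lemma image_zmod_closed h : zmod_closed (image_pred h).
Proof.
split=> [|x y]; first by apply/asboolP; exists 0; rewrite linear0.
by move=> /asboolP[u <-] /asboolP[v <-]; apply/asboolP; exists (u - v); rewrite linearB.
Qed.
HB.instance Definition _ h :=
  GRing.isZmodClosed.Build V (image_pred h) (image_zmod_closed h).

Definition Coker h : Type := Quotient.quot (image_pred h : zmodClosed V).
HB.instance Definition _ h := GRing.Zmodule.on (Coker h).
HB.instance Definition _ h := ZmodQuotient.on (Coker h).
End Linear.

Section CokerModule.
Context (R : pzRingType) (U V : lmodType R) (h : {linear U -> V}).
Implicit Types (a b : R) (q : Coker h) (v : V).

Definition coker_proj v : Coker h := \pi_(Coker h) v.

Lemma coker_proj_eq v w :
  (coker_proj v = coker_proj w) <-> exists u, h u = v - w.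
Proof.
split=> [/eqP|]; rewrite /coker_proj; first by rewrite -Quotient.idealrBE => /asboolP.
by move=> hu; apply/eqP; rewrite -Quotient.idealrBE; apply/asboolP.
Qed.

Lemma coker_projD v w : coker_proj (v + w) = coker_proj v + coker_proj w.
Proof. by rewrite /coker_proj -pi_addr. Qed.

Lemma coker_projK q : coker_proj (repr q) = q.
Proof. exact: reprK. Qed.

Definition coker_scale a q : Coker h := coker_proj (a *: repr q).

Lemma coker_scale_proj a v : coker_scale a (coker_proj v) = coker_proj (a *: v).
Proof.
apply/coker_proj_eq; have /coker_proj_eq[u hu] := coker_projK (coker_proj v).
by exists (a *: u); rewrite linearZ hu -scalerBr.
Qed.

Lemma coker_scaleA a b q : coker_scale a (coker_scale b q) = coker_scale (a * b) q.
Proof. by rewrite -[q]coker_projK !coker_scale_proj scalerA. Qed.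
Lemma coker_scale1 : left_id 1 coker_scale.
Proof. by move=> q; rewrite -[q]coker_projK coker_scale_proj scale1r. Qed.
Lemma coker_scaleDr : right_distributive coker_scale +%R.
Proof.
move=> a q r; rewrite -[q]coker_projK -[r]coker_projK.
by rewrite -coker_projD !coker_scale_proj scalerDr coker_projD.
Qed.
Lemma coker_scaleDl q : {morph coker_scale^~ q : a b / a + b}.
Proof.
by move=> a b; rewrite -[q]coker_projK !coker_scale_proj scalerDl coker_projD.
Qed.
HB.instance Definition _ := GRing.Zmodule_isLmodule.Build R (Coker h)
  coker_scaleA coker_scale1 coker_scaleDr coker_scaleDl.

Lemma coker_proj_linear : linear coker_proj.
Proof. by move=> a v w; rewrite coker_projD -coker_scale_proj. Qed.
HB.instance Definition _ :=
  GRing.isLinear.Build R V (Coker h) *:%R coker_proj coker_proj_linear.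
End CokerModule.

Section Hom.
Context (A : pzRingType) (U X : lmodType A).

Definition hom : Type := {linear U -> X}.
Definition hom_fun (h : hom) : U -> X := (h : {linear U -> X}).
Coercion hom_fun : hom >-> Funclass.

HB.instance Definition _ := gen_eqMixin hom.
HB.instance Definition _ := gen_choiceMixin hom.

Lemma hom_ext (h k : hom) : h =1 k -> h = k.
Proof.
case: h k => [h [[hD] [hZ]]] [k [[kD] [kZ]]] /funext E.
rewrite /hom_fun /= in E; rewrite -E in kD kZ *.
by rewrite (Prop_irrelevance kD hD) (Prop_irrelevance kZ hZ).
Qed.

Definition hom_zero : hom := (\0 : U -> X) : {linear U -> X}.
Definition hom_opp (h : hom) : hom := (\- (h : {linear U -> X})) : {linear U -> X}.
Definition hom_add (h k : hom) : hom :=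
  ((h : {linear U -> X}) \+ (k : {linear U -> X})) : {linear U -> X}.

Lemma hom_addA : associative hom_add.
Proof. by move=> h k l; apply: hom_ext => u /=; rewrite /hom_fun /= addrA. Qed.
Lemma hom_addC : commutative hom_add.
Proof. by move=> h k; apply: hom_ext => u /=; rewrite /hom_fun /= addrC. Qed.
Lemma hom_add0 : left_id hom_zero hom_add.
Proof. by move=> h; apply: hom_ext => u /=; rewrite /hom_fun /= add0r. Qed.
Lemma hom_addN : left_inverse hom_zero hom_opp hom_add.
Proof. by move=> h; apply: hom_ext => u /=; rewrite /hom_fun /= addNr. Qed.
HB.instance Definition _ := GRing.isZmodule.Build hom
  hom_addA hom_addC hom_add0 hom_addN.
End Hom.

(* [Hom_A(N, X)] is a left [B]-module through the right action of [B] on [N]. *)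
Section HomModule.
Context (A B : pzRingType) (N : bimodType A B) (X : lmodType A).
Implicit Types (h k : hom N X).

Definition hom_scale_fun b h (n : N) : X := h (ract n b).
Lemma hom_scale_linear b h : linear (hom_scale_fun b h).
Proof.
by move=> a n n'; rewrite /hom_scale_fun ractDl ractZl /hom_fun linearP.
Qed.
HB.instance Definition _ b h := GRing.isLinear.Build A N X *:%R
  (hom_scale_fun b h) (hom_scale_linear b h).
Definition hom_scale b h : hom N X := hom_scale_fun b h : {linear N -> X}.

Lemma hom_scaleE b h n : hom_scale b h n = h (ract n b).
Proof. by []. Qed.
Lemma hom_scaleA b b' h : hom_scale b (hom_scale b' h) = hom_scale (b * b') h.
Proof. by apply: hom_ext => n; rewrite !hom_scaleE ractA. Qed.
Lemma hom_scale1 : left_id 1 hom_scale.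
Proof. by move=> h; apply: hom_ext => n; rewrite hom_scaleE ract1. Qed.
Lemma hom_scaleDr : right_distributive hom_scale +%R.
Proof. by move=> b h k; apply: hom_ext => n. Qed.
Lemma hom_scaleDl h : {morph hom_scale^~ h : b b' / b + b'}.
Proof.
by move=> b b'; apply: hom_ext => n; rewrite hom_scaleE ractDr /hom_fun linearD.
Qed.
HB.instance Definition _ := GRing.Zmodule_isLmodule.Build B (hom N X)
  hom_scaleA hom_scale1 hom_scaleDr hom_scaleDl.
End HomModule.

Section Tensor.
Context (B A : pzRingType) (M : bimodType B A) (X : lmodType A).
Local Notation F := {freeg (M * X)%type}.

Inductive tensor_relator : F -> Prop :=
| Tensor_addl m m' x :
    tensor_relator (<< (m + m', x) >> - << (m, x) >> - << (m', x) >>)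
| Tensor_addr m x x' :
    tensor_relator (<< (m, x + x') >> - << (m, x) >> - << (m, x') >>)
| Tensor_balanced m a x :
    tensor_relator (<< (ract m a, x) >> - << (m, a *: x) >>).

(* the subgroup generated by the relators *)
Definition tensor_relations : {pred F} := fun g =>
  `[< forall S : zmodClosed F, (forall r, tensor_relator r -> r \in S) -> g \in S >].

Lemma tensor_relations_zmod_closed : zmod_closed tensor_relations.
Proof.
split=> [|g g' /asboolP hg /asboolP hg']; apply/asboolP => S hS.
  exact: rpred0.
by rewrite rpredB ?hg ?hg'.
Qed.
HB.instance Definition _ :=
  GRing.isZmodClosed.Build F tensor_relations tensor_relations_zmod_closed.

Definition tensor : Type := Quotient.quot (tensor_relations : zmodClosed F).
HB.instance Definition _ := GRing.Zmodule.on tensor.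
HB.instance Definition _ := ZmodQuotient.on tensor.

Definition tens (m : M) (x : X) : tensor := \pi_tensor << (m, x) >>.

Lemma tensor_relatorP g : tensor_relator g -> \pi_tensor g = 0.
Proof.
move=> hg; have : \pi_tensor g == \pi_tensor 0.
  by rewrite -Quotient.idealrBE subr0; apply/asboolP => S; apply.
by move=> /eqP ->; rewrite pi_zeror.
Qed.

Lemma tensDl m m' x : tens (m + m') x = tens m x + tens m' x.
Proof.
have := tensor_relatorP (Tensor_addl m m' x).
by rewrite !raddfB -addrA -opprD => /subr0_eq.
Qed.
Lemma tensDr m x x' : tens m (x + x') = tens m x + tens m x'.
Proof.
have := tensor_relatorP (Tensor_addr m x x').
by rewrite !raddfB -addrA -opprD => /subr0_eq.
Qed.
Lemma tens_ract m a x : tens (ract m a) x = tens m (a *: x).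
Proof.
have := tensor_relatorP (Tensor_balanced m a x).
by rewrite !raddfB => /subr0_eq.
Qed.

Lemma tens0l x : tens 0 x = 0.
Proof. by apply: (addrI (tens 0 x)); rewrite -tensDl !addr0. Qed.
Lemma tens0r m : tens m 0 = 0.
Proof. by apply: (addrI (tens m 0)); rewrite -tensDr !addr0. Qed.
Lemma tensNl m x : tens (- m) x = - tens m x.
Proof. by apply/eqP; rewrite -addr_eq0 -tensDl addNr tens0l. Qed.

Lemma tensor_sumP (t : tensor) :
  exists s : seq (M * X), t = \sum_(p <- s) tens p.1 p.2.
Proof.
pose S (u : tensor) := exists s : seq (M * X), u = \sum_(p <- s) tens p.1 p.2.
have SD u v : S u -> S v -> S (u + v).
  by move=> [s ->] [s' ->]; exists (s ++ s'); rewrite big_cat.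
have SN u : S u -> S (- u).
  move=> [s ->]; exists [seq (- p.1, p.2) | p <- s]; rewrite big_map -sumrN.
  by apply: eq_bigr => p _; rewrite tensNl.
have S0 : S 0 by exists [::]; rewrite big_nil.
have Sn u n : S u -> S (u *+ n).
  by move=> Su; elim: n => [|n IHn]; rewrite ?mulr0n // mulrS; apply: SD.
rewrite -/(S t) -[t]reprK -[repr t]freeg_sumE raddf_sum /=.
elim: (dom _) => [|[m x] r IHr]; rewrite ?big_nil // big_cons; apply: SD => //.
rewrite -[coeff _ _]intz -freegU_mulz raddfMz /= -/(tens m x).
have S1 : S (tens m x) by exists [:: (m, x)]; rewrite big_seq1.
by case: (coeff _ _) => n; rewrite ?NegzE ?mulrNz -?pmulrn; [|apply: SN]; apply: Sn.
Qed.

Lemma tensor_ind (P : tensor -> Prop) :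
  P 0 -> (forall m x t, P t -> P (tens m x + t)) -> forall t, P t.
Proof.
move=> P0 PD t; have [s ->] := tensor_sumP t.
by elim: s => [|p s IHs]; rewrite ?big_nil // big_cons; apply: PD.
Qed.

Lemma tensor_ext (Z : zmodType) (u v : tensor -> Z) :
    zmod_morphism u -> zmod_morphism v ->
  (forall m x, u (tens m x) = v (tens m x)) -> u =1 v.
Proof.
move=> uB vB uv.
pose U : {additive tensor -> Z} := HB.pack u (GRing.isZmodMorphism.Build _ _ u uB).
pose V : {additive tensor -> Z} := HB.pack v (GRing.isZmodMorphism.Build _ _ v vB).
elim/tensor_ind => [|m x t IH]; first by rewrite [u 0](raddf0 U) [v 0](raddf0 V).
by rewrite [u _](raddfD U) [v _](raddfD V) /= IH uv.
Qed.

Definition balanced (Z : zmodType) (beta : M -> X -> Z) : Prop :=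
  [/\ forall m m' x, beta (m + m') x = beta m x + beta m' x,
      forall m x x', beta m (x + x') = beta m x + beta m x'
    & forall m a x, beta (ract m a) x = beta m (a *: x)].

(* The map induced by [beta]; it is additive and sends [tens m x] to
   [beta m x] as soon as [beta] is balanced. *)
Definition tensor_lift (Z : zmodType) (beta : M -> X -> Z) (t : tensor) : Z :=
  fglift (fun p : M * X => beta p.1 p.2 : zmodule Z) (repr t).

Section Lift.
Context (Z : zmodType) (beta : M -> X -> Z) (beta_bal : balanced beta).

Let lift (g : F) : zmodule Z := fglift (fun p : M * X => beta p.1 p.2 : zmodule Z) g.

Let lift_additive : zmod_morphism lift.
Proof. exact: lift_is_additive. Qed.
HB.instance Definition _ :=
  GRing.isZmodMorphism.Build F (zmodule Z) lift lift_additive.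

Let liftE p : lift << p >> = beta p.1 p.2.
Proof. by rewrite /lift liftU scale1r. Qed.

Let lift_ker : {pred F} := fun g => lift g == 0.
Let lift_ker_closed : zmod_closed lift_ker.
Proof.
split=> [|f f']; rewrite !unfold_in ?raddf0 // => /eqP hf /eqP hf'.
by rewrite /lift_ker raddfB /= hf hf' subr0.
Qed.
HB.instance Definition _ := GRing.isZmodClosed.Build F lift_ker lift_ker_closed.

Let lift_relations g : g \in tensor_relations -> lift g = 0.
Proof.
move=> /asboolP /(_ (lift_ker : zmodClosed F)) gK; apply/eqP; apply: gK => r.
case: beta_bal => bl br ba.
by case=> [m m' x|m x x'|m a x]; rewrite unfold_in /lift_ker !raddfB /= !liftE /= ?bl ?br ?ba
  ?subrr // -addrA -opprD subrr.
Qed.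

Lemma tensor_lift_pi g : tensor_lift beta (\pi_tensor g) = lift g.
Proof.
apply/eqP; rewrite -[tensor_lift _ _]/(lift _) -subr_eq0 -raddfB.
apply/eqP/lift_relations; rewrite Quotient.idealrBE.
by rewrite reprK.
Qed.

Lemma tensor_liftE m x : tensor_lift beta (tens m x) = beta m x.
Proof. by rewrite tensor_lift_pi liftE. Qed.

Lemma tensor_lift_additive : zmod_morphism (tensor_lift beta).
Proof.
move=> t u; rewrite -[t]reprK -[u]reprK -raddfB !tensor_lift_pi.
exact: raddfB.
Qed.
End Lift.
End Tensor.

Section TensorModule.
Context (B A : pzRingType) (M : bimodType B A) (X : lmodType A).
Implicit Types (t u : tensor M X) (b : B).

Definition tensor_scale b : tensor M X -> tensor M X :=
  tensor_lift (fun m x => tens (b *: m) x).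

Lemma tensor_scale_balanced b :
  balanced (fun (m : M) (x : X) => tens (b *: m) x).
Proof.
split=> [m m' x|m x x'|m a x]; first by rewrite scalerDr tensDl.
  by rewrite tensDr.
by rewrite -ractZl tens_ract.
Qed.

Lemma tensor_scaleE b m x : tensor_scale b (tens m x) = tens (b *: m) x.
Proof. exact: (tensor_liftE (tensor_scale_balanced b)). Qed.

Lemma tensor_scaleB b : zmod_morphism (tensor_scale b).
Proof. exact: (tensor_lift_additive (tensor_scale_balanced b)). Qed.
HB.instance Definition _ b :=
  GRing.isZmodMorphism.Build _ _ (tensor_scale b) (tensor_scaleB b).

Lemma tensor_scaleA b b' t : tensor_scale b (tensor_scale b' t) = tensor_scale (b * b') t.
Proof.
elim/tensor_ind: t => [|m x t IH]; first by rewrite !raddf0.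
by rewrite !raddfD /= IH !tensor_scaleE scalerA.
Qed.
Lemma tensor_scale1 : left_id 1 tensor_scale.
Proof.
elim/tensor_ind => [|m x t IH]; first by rewrite !raddf0.
by rewrite !raddfD /= IH !tensor_scaleE scale1r.
Qed.
Lemma tensor_scaleDr : right_distributive tensor_scale +%R.
Proof. by move=> b t u; rewrite raddfD. Qed.
Lemma tensor_scaleDl t : {morph tensor_scale^~ t : b b' / b + b'}.
Proof.
move=> b b'; elim/tensor_ind: t => [|m x t IH]; first by rewrite !raddf0 addr0.
by rewrite !raddfD /= IH !tensor_scaleE scalerDl tensDl addrACA.
Qed.
HB.instance Definition _ := GRing.Zmodule_isLmodule.Build B (tensor M X)
  tensor_scaleA tensor_scale1 tensor_scaleDr tensor_scaleDl.

Lemma tensZ b m x : b *: tens m x = tens (b *: m) x.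
Proof. exact: tensor_scaleE. Qed.
End TensorModule.

Section TensorBimodule.
Context (B A C : pzRingType) (M : bimodType B A) (X : bimodType A C).
Implicit Types (t u : tensor M X) (c : C).

Definition tensor_ract (t : tensor M X) c : tensor M X :=
  tensor_lift (fun m x => tens m (ract x c)) t.

Lemma tensor_ract_balanced c :
  balanced (fun (m : M) (x : X) => tens m (ract x c)).
Proof.
split=> [m m' x|m x x'|m a x]; first by rewrite tensDl.
  by rewrite ractDl tensDr.
by rewrite tens_ract ractZl.
Qed.

Lemma tensor_ractE m x c : tensor_ract (tens m x) c = tens m (ract x c).
Proof. exact: (tensor_liftE (tensor_ract_balanced c)). Qed.

Lemma tensor_ractB c : zmod_morphism (tensor_ract^~ c).
Proof. exact: (tensor_lift_additive (tensor_ract_balanced c)). Qed.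

Lemma tensor_ract0 c : tensor_ract 0 c = 0.
Proof. by rewrite -[X in tensor_ract X](subrr 0) tensor_ractB subrr. Qed.
Lemma tensor_ractDl c : {morph tensor_ract^~ c : t u / t + u}.
Proof.
move=> t u; rewrite -[u in LHS]opprK tensor_ractB; congr (_ + _).
by rewrite -[- u]add0r tensor_ractB tensor_ract0 add0r opprK.
Qed.
Lemma tensor_ractDr t : {morph tensor_ract t : c c' / c + c'}.
Proof.
move=> c c'; elim/tensor_ind: t => [|m x t IH]; first by rewrite !tensor_ract0 addr0.
by rewrite !tensor_ractDl IH !tensor_ractE ractDr tensDr addrACA.
Qed.
Lemma tensor_ractA t c c' : tensor_ract t (c * c') = tensor_ract (tensor_ract t c) c'.
Proof.
elim/tensor_ind: t => [|m x t IH]; first by rewrite !tensor_ract0.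
by rewrite !tensor_ractDl IH !tensor_ractE ractA.
Qed.
Lemma tensor_ract1 t : tensor_ract t 1 = t.
Proof.
elim/tensor_ind: t => [|m x t IH]; first by rewrite !tensor_ract0.
by rewrite !tensor_ractDl IH !tensor_ractE ract1.
Qed.
Lemma tensor_ractZl (b : B) t c : tensor_ract (b *: t) c = b *: tensor_ract t c.
Proof.
elim/tensor_ind: t => [|m x t IH]; first by rewrite !(scaler0, tensor_ract0).
by rewrite !(scalerDr, tensor_ractDl) IH !(tensZ, tensor_ractE).
Qed.
HB.instance Definition _ := Lmodule_isBimodule.Build B C (tensor M X)
  tensor_ractDl tensor_ractDr tensor_ractA tensor_ract1 tensor_ractZl.

Lemma ract_tens m x c : ract (tens m x) c = tens m (ract x c).
Proof. exact: tensor_ractE. Qed.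
End TensorBimodule.

Section TensorMap.
Context (B A : pzRingType) (M : bimodType B A) (X Y : lmodType A).
Variable h : {linear X -> Y}.

(* the map [M (x) h] *)
Definition tensor_map : tensor M X -> tensor M Y :=
  tensor_lift (fun m x => tens m (h x)).

Lemma tensor_map_balanced : balanced (fun (m : M) (x : X) => tens m (h x)).
Proof.
split=> [m m' x|m x x'|m a x]; first by rewrite tensDl.
  by rewrite linearD tensDr.
by rewrite tens_ract linearZ.
Qed.

Lemma tensor_mapE m x : tensor_map (tens m x) = tens m (h x).
Proof. exact: (tensor_liftE tensor_map_balanced). Qed.

Lemma tensor_mapB : zmod_morphism tensor_map.
Proof. exact: (tensor_lift_additive tensor_map_balanced). Qed.
HB.instance Definition _ := GRing.isZmodMorphism.Build _ _ tensor_map tensor_mapB.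

Lemma tensor_mapZ : scalable tensor_map.
Proof.
move=> b t; elim/tensor_ind: t => [|m x t IH]; first by rewrite !(scaler0, raddf0).
by rewrite !(scalerDr, raddfD) /= IH !(tensZ, tensor_mapE).
Qed.
HB.instance Definition _ := GRing.isScalable.Build _ _ _ _ tensor_map tensor_mapZ.
End TensorMap.
Arguments tensor_map {B A} M {X Y} h.

Section TensorHom.
Context (A B : pzRingType) (N : bimodType A B) (X : lmodType A) (Y : lmodType B).
Variable g : {linear tensor N Y -> X}.

Definition adjoint_fun (y : Y) (n : N) : X := g (tens n y).
Lemma adjoint_fun_linear y : linear (adjoint_fun y).
Proof. by move=> a n n'; rewrite /adjoint_fun tensDl -tensZ linearP. Qed.
HB.instance Definition _ y :=
  GRing.isLinear.Build A N X *:%R (adjoint_fun y) (adjoint_fun_linear y).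

Definition adjoint (y : Y) : hom N X := adjoint_fun y : {linear N -> X}.

Lemma adjointE y n : adjoint y n = g (tens n y).
Proof. by []. Qed.

Lemma adjoint_linear : linear adjoint.
Proof.
move=> b y y'; apply: hom_ext => n.
rewrite adjointE tensDr linearD; congr (_ + _).
by rewrite [RHS]hom_scaleE adjointE tens_ract.
Qed.
HB.instance Definition _ :=
  GRing.isLinear.Build B Y (hom N X) *:%R adjoint adjoint_linear.
End TensorHom.

Section Homological.
Context (R : pzRingType).
Implicit Types U V W X Y Z : lmodType R.

Definition surjective (S T : Type) (h : S -> T) : Prop := forall y, exists x, h x = y.

Definition exact_at U V W (h : {linear U -> V}) (k : {linear V -> W}) : Prop :=
  forall v, k v = 0 <-> exists u, h u = v.

Definition short_exact U V W (i : {linear U -> V}) (p : {linear V -> W}) : Prop :=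
  [/\ injective i, exact_at i p & surjective p].

Definition projective (P : lmodType R) : Prop :=
  forall U V (p : {linear U -> V}) (h : {linear P -> V}), surjective p ->
    exists k : {linear P -> U}, forall x, p (k x) = h x.

Record projective_resolution X := ProjectiveResolution {
  res_obj : nat -> lmodType R;
  res_diff : forall n, {linear res_obj n.+1 -> res_obj n};
  res_aug : {linear res_obj 0 -> X};
  res_projective : forall n, projective (res_obj n);
  res_aug_surjective : surjective res_aug;
  res_exact0 : exact_at (res_diff 0) res_aug;
  res_exactS : forall n, exact_at (res_diff n.+1) (res_diff n)
}.

(* [Ext^1(X, Y) = 0], i.e., [H^1(Hom(P, Y)) = 0] for the projective resolutions
   [P] of [X].  These exist, and they all have the same cohomology. *)
Definition Ext1_eq0 X Y : Prop :=
  forall (P : projective_resolution X) (h : {linear res_obj P 1 -> Y}),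
    (forall x, h (res_diff P 1 x) = 0) ->
    exists k : {linear res_obj P 0 -> Y}, forall x, h x = k (res_diff P 0 x).

Definition right_perp (C : lmodType R -> Prop) : lmodType R -> Prop :=
  fun X => forall W, C W -> Ext1_eq0 W X.

Definition left_perp (C : lmodType R -> Prop) : lmodType R -> Prop :=
  fun X => forall W, C W -> Ext1_eq0 X W.

Definition cotorsion_pair (C D : lmodType R -> Prop) : Prop :=
  (forall X, right_perp C X <-> D X) /\ (forall X, left_perp D X <-> C X).

Definition complete_pair (C D : lmodType R -> Prop) : Prop :=
  forall Z,
    (exists (D1 C1 : lmodType R) (i : {linear D1 -> C1}) (p : {linear C1 -> Z}),
       [/\ C C1, D D1 & short_exact i p]) /\
    (exists (D2 C2 : lmodType R) (i : {linear Z -> D2}) (p : {linear D2 -> C2}),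
       [/\ C C2, D D2 & short_exact i p]).

Definition hereditary_pair (C D : lmodType R -> Prop) : Prop :=
  (forall U V (p : {linear U -> V}), C U -> C V -> surjective p -> C (Ker p)) /\
  (forall U V (i : {linear U -> V}), D U -> D V -> injective i -> D (Coker i)).

Definition isomorphic X Y : Prop := exists h : {linear X -> Y}, bijective h.
End Homological.

(* [Tor_1^A(M, X) = 0], i.e., [H_1(M (x) P) = 0] for the projective resolutions
   [P] of [X]. *)
Definition Tor1_eq0 (B A : pzRingType) (M : bimodType B A) (X : lmodType A) : Prop :=
  forall P : projective_resolution X,
    exact_at (tensor_map M (res_diff P 1)) (tensor_map M (res_diff P 0)).

Record morita_context (A B : pzRingType) := MoritaContext {
  mctx_M : bimodType B A;
  mctx_N : bimodType A B;
  mctx_phi : {additive tensor mctx_M mctx_N -> B};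
  mctx_phiZ : forall b t, mctx_phi (b *: t) = b * mctx_phi t;
  mctx_phi_ract : forall t b, mctx_phi (ract t b) = mctx_phi t * b;
  mctx_psi : {additive tensor mctx_N mctx_M -> A};
  mctx_psiZ : forall a t, mctx_psi (a *: t) = a * mctx_psi t;
  mctx_psi_ract : forall t a, mctx_psi (ract t a) = mctx_psi t * a;
  mctx_assocM : forall (m' : mctx_M) (n : mctx_N) (m : mctx_M),
    ract m' (mctx_psi (tens n m)) = mctx_phi (tens m' n) *: m;
  mctx_assocN : forall (n' : mctx_N) (m : mctx_M) (n : mctx_N),
    ract n' (mctx_phi (tens m n)) = mctx_psi (tens n' m) *: n
}.

Section MoritaRing.
Context (A B : pzRingType) (c : morita_context A B).
Local Notation M := (mctx_M c).
Local Notation N := (mctx_N c).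
Local Notation phi := (mctx_phi c).
Local Notation psi := (mctx_psi c).

(* the matrix with rows [(ul, ur)] and [(dl, dr)] *)
Record morita_ring := MoritaRing { ul : A; ur : N; dl : M; dr : B }.
Implicit Types r s t : morita_ring.

Definition tuple_of_morita r := (ul r, ur r, dl r, dr r).
Definition morita_of_tuple (p : A * N * M * B) :=
  MoritaRing p.1.1.1 p.1.1.2 p.1.2 p.2.
Lemma tuple_of_moritaK : cancel tuple_of_morita morita_of_tuple.
Proof. by case. Qed.
HB.instance Definition _ := Choice.copy morita_ring (can_type tuple_of_moritaK).

Definition morita_zero := MoritaRing 0 0 0 0.
Definition morita_opp r := MoritaRing (- ul r) (- ur r) (- dl r) (- dr r).
Definition morita_add r s :=
  MoritaRing (ul r + ul s) (ur r + ur s) (dl r + dl s) (dr r + dr s).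

Lemma morita_addA : associative morita_add.
Proof. by move=> r s t; congr MoritaRing; exact: addrA. Qed.
Lemma morita_addC : commutative morita_add.
Proof. by move=> r s; congr MoritaRing; exact: addrC. Qed.
Lemma morita_add0 : left_id morita_zero morita_add.
Proof. by case=> a n m b; congr MoritaRing; exact: add0r. Qed.
Lemma morita_addN : left_inverse morita_zero morita_opp morita_add.
Proof. by move=> r; congr MoritaRing; exact: addNr. Qed.
HB.instance Definition _ := GRing.isZmodule.Build morita_ring
  morita_addA morita_addC morita_add0 morita_addN.

Definition morita_one := MoritaRing 1 0 0 1.
Definition morita_mul r s := MoritaRing
  (ul r * ul s + psi (tens (ur r) (dl s)))
  (ul r *: ur s + ract (ur r) (dr s))
  (ract (dl r) (ul s) + dr r *: dl s)
  (phi (tens (dl r) (ur s)) + dr r * dr s).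

Lemma ract0l (C D : pzRingType) (L : bimodType C D) d : ract (0 : L) d = 0.
Proof. by apply: (addrI (ract 0 d)); rewrite -ractDl !addr0. Qed.
Lemma ract0r (C D : pzRingType) (L : bimodType C D) (l : L) : ract l 0 = 0.
Proof. by apply: (addrI (ract l 0)); rewrite -ractDr !addr0. Qed.

Lemma morita_mulA : associative morita_mul.
Proof.
move=> [a n m b] [a' n' m' b'] [a'' n'' m'' b'']; rewrite /morita_mul /=.
congr MoritaRing.
- rewrite mulrDr mulrDl tensDl tensDr !raddfD /= -tensZ mctx_psiZ tens_ract.
  by rewrite -ract_tens mctx_psi_ract mulrA addrACA.
- rewrite scalerDr scalerDl ractDl ractDr mctx_assocN -ractA ractZl scalerA.
  by rewrite addrACA.
- rewrite scalerDr scalerDl ractDl ractDr mctx_assocM -ractA ractZl scalerA.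
  by rewrite addrACA.
rewrite mulrDr mulrDl tensDl tensDr !raddfD /= -tensZ mctx_phiZ tens_ract.
by rewrite -ract_tens mctx_phi_ract mulrA addrACA.
Qed.
Lemma morita_mul1 : left_id morita_one morita_mul.
Proof.
case=> a n m b; congr MoritaRing => /=.
- by rewrite mul1r tens0l raddf0 addr0.
- by rewrite scale1r ract0l addr0.
- by rewrite ract0l scale1r add0r.
by rewrite tens0l raddf0 add0r mul1r.
Qed.
Lemma morita_mulr1 : right_id morita_one morita_mul.
Proof.
case=> a n m b; congr MoritaRing => /=.
- by rewrite mulr1 tens0r raddf0 addr0.
- by rewrite scaler0 ract1 add0r.
- by rewrite scaler0 ract1 addr0.
by rewrite tens0r raddf0 add0r mulr1.
Qed.
Lemma morita_mulDl : left_distributive morita_mul +%R.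
Proof.
move=> r s t; congr MoritaRing => /=.
- by rewrite mulrDl tensDl raddfD addrACA.
- by rewrite scalerDl ractDl addrACA.
- by rewrite scalerDl ractDl addrACA.
by rewrite mulrDl tensDl raddfD addrACA.
Qed.
Lemma morita_mulDr : right_distributive morita_mul +%R.
Proof.
move=> r s t; congr MoritaRing => /=.
- by rewrite mulrDr tensDr raddfD addrACA.
- by rewrite scalerDr ractDr addrACA.
- by rewrite scalerDr ractDr addrACA.
by rewrite mulrDr tensDr raddfD addrACA.
Qed.
HB.instance Definition _ := GRing.Zmodule_isPzRing.Build morita_ring
  morita_mulA morita_mul1 morita_mulr1 morita_mulDl morita_mulDr.

Record quadruple := Quadruple {
  quad_X : lmodType A;
  quad_Y : lmodType B;
  quad_f : {linear tensor M quad_X -> quad_Y};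
  quad_g : {linear tensor N quad_Y -> quad_X};
  quad_gf : forall (n : N) (m : M) (x : quad_X),
    quad_g (tens n (quad_f (tens m x))) = psi (tens n m) *: x;
  quad_fg : forall (m : M) (n : N) (y : quad_Y),
    quad_f (tens m (quad_g (tens n y))) = phi (tens m n) *: y
}.

(* the left module over the Morita ring identified with the quadruple [q]:
   the column vectors over [X] and [Y] *)
Definition quad_module (q : quadruple) : Type := (quad_X q * quad_Y q)%type.
HB.instance Definition _ q :=
  GRing.Zmodule.copy (quad_module q) (quad_X q * quad_Y q)%type.

Section QuadModule.
Variable q : quadruple.
Implicit Type z : quad_module q.

Definition quad_scale r z : quad_module q :=
  (ul r *: z.1 + quad_g q (tens (ur r) z.2),
   quad_f q (tens (dl r) z.1) + dr r *: z.2).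

Lemma quad_scaleA r s z : quad_scale r (quad_scale s z) = quad_scale (r * s) z.
Proof.
case: r s z => [a n m b] [a' n' m' b'] [x y]; congr pair => /=.
  rewrite !scalerDr !scalerDl !tensDr !tensDl !linearD /= quad_gf !scalerA.
  rewrite -tensZ linearZ /= tens_ract -!addrA; congr (_ + _).
  by rewrite addrCA.
rewrite !scalerDr !scalerDl !tensDr !tensDl !linearD /= quad_fg !scalerA.
rewrite -tensZ linearZ /= tens_ract -!addrA; congr (_ + _).
by rewrite addrCA.
Qed.
Lemma quad_scale1 : left_id 1 quad_scale.
Proof.
case=> x y; congr pair => /=; rewrite tens0l linear0 scale1r ?addr0 //.
by rewrite add0r.
Qed.
Lemma quad_scaleDr : right_distributive quad_scale +%R.
Proof.
move=> r z w; congr pair => /=; rewrite tensDr linearD scalerDr addrACA //.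
Qed.
Lemma quad_scaleDl z : {morph quad_scale^~ z : r s / r + s}.
Proof.
by move=> r s; congr pair => /=; rewrite tensDl linearD scalerDl addrACA.
Qed.
HB.instance Definition _ := GRing.Zmodule_isLmodule.Build morita_ring
  (quad_module q) quad_scaleA quad_scale1 quad_scaleDr quad_scaleDl.
End QuadModule.

Definition class_M (U : lmodType A -> Prop) (V : lmodType B -> Prop)
    (L : lmodType morita_ring) : Prop :=
  exists q : quadruple, isomorphic L (quad_module q) /\
    [/\ V (Coker (quad_f q)), U (quad_X q) & injective (quad_f q)].

Definition class_N (X : lmodType A -> Prop) (Y : lmodType B -> Prop)
    (L : lmodType morita_ring) : Prop :=
  exists q : quadruple, isomorphic L (quad_module q) /\
    [/\ Y (Ker (adjoint (quad_g q))), X (quad_X q) & surjective (adjoint (quad_g q))].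
End MoritaRing.

Arguments class_M {A B} c U V L.
Arguments class_N {A B} c X Y L.

(* Main.v *)
(* Since M (x) N = 0, the map phi vanishes, and three functors into the Morita
   ring modules are at hand: T W = (W, M (x) W), left adjoint to (X, Y) |-> X;
   H W = (W, Hom(N, W)), right adjoint to it; and Z V = (0, V), which has the left
   adjoint Coker f and the right adjoint Ker g~.  If f is injective there is an
   exact sequence 0 -> T X -> (X, Y) -> Z (Coker f) -> 0, and if g~ is surjective
   there is 0 -> Z (Ker g~) -> (X, Y) -> H X -> 0.

   With the Tor (resp. Ext) hypothesis T (resp. H) preserves the relevant short
   exact sequences, and extending the counit T X -> (X, Y) (resp. lifting the
   unit) identifies N as the right perp of the T U and Z V, and M as the left perp
   of the H X and Z Y.  Surjectivity of g~ is tested against Z B, injectivity of f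
   against Z of the injective cogenerator Hom_Z(B, Q/Z).

   For completeness, a module is first pushed out along T of a special preenvelope
   of X, so that X lies in the right class; then g~ : Y -> Hom(N, X) is factored as
   a monomorphism with cokernel in V followed by an epimorphism with kernel in Y.
   The other sequence is dual. *)

From HB Require Import structures.
Require Import Defs.
From mathcomp Require Import all_boot ssralg ssrnum ssrint rat boolp classical_sets freeg.

Set Implicit Arguments.
Unset Strict Implicit.
Unset Printing Implicit Defensive.

Import GRing.Theory Num.Theory.
Local Open Scope ring_scope.

(** * Linear maps and exact sequences *)

(** Vanishing of Ext is defined by resolutions, but once [split_ext], [ext_extend] and [ext_lift]
    are available it is used only as a splitting, extension or lifting property of short exact
    sequences; this takes the place of long exact sequences.

    Quadruples are constructed from f and g~ instead of f and g. The condition on g f then becomes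
    the single equation g~ f = [psi_hom], the canonical map M (x) X -> Hom(N, X), while the
    condition on f g is automatic: both of its sides are images of an element of M (x) N. Since psi
    may be nonzero, this one equation has to be respected by every extension built below, and it is
    stable under the changes that occur: composing f with a map Y -> F through which g~ factors, or
    replacing Y by some F -> Y through which f factors. *)

Section Exactness.
Context (R : pzRingType).
Implicit Types (U V W A C D E K X Y Z : lmodType R).

(** Bundles a function constructed in the middle of a proof; only its values are remembered
    afterwards. *)
Lemma linear_map U V (f : U -> V) : linear f -> exists h : {linear U -> V}, h =1 f.
Proof.
move=> fL; pose h : {linear U -> V} := HB.pack f (GRing.isLinear.Build R U V *:%R f fL).
by exists h.
Qed.

Lemma factor_through_epi U V Z (p : {linear U -> V}) (h : {linear U -> Z}) :
    surjective p -> (forall u, p u = 0 -> h u = 0) ->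
  exists k : {linear V -> Z}, forall u, k (p u) = h u.
Proof.
move=> ps ph; pose s v := sval (cid (ps v)).
have sK v : p (s v) = v by rewrite /s; case: cid.
have hE u u' : p u = p u' -> h u = h u'.
  by move=> e; apply/subr0_eq; rewrite -linearB ph // linearB e subrr.
have [|k kE] := @linear_map V Z (h \o s).
  by move=> a v w /=; rewrite -linearP; apply: hE; rewrite linearP !sK.
by exists k => u; rewrite kE /=; apply: hE.
Qed.

Lemma factor_through_mono U V Z (i : {linear U -> V}) (h : {linear Z -> V}) :
    injective i -> (forall z, exists u, i u = h z) ->
  exists k : {linear Z -> U}, forall z, i (k z) = h z.
Proof.
move=> ii ih; pose k z := sval (cid (ih z)).
have kK z : i (k z) = h z by rewrite /k; case: cid.
have [|k' k'E] := @linear_map Z U k.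
  by move=> a z z'; apply: ii; rewrite linearP !kK linearP.
by exists k' => z; rewrite k'E.
Qed.

Lemma linear_inj U V (h : {linear U -> V}) :
  (forall u, h u = 0 -> u = 0) -> injective h.
Proof. by move=> h0 u u' e; apply/subr0_eq/h0; rewrite linearB e subrr. Qed.

Lemma coker_proj_surjective U V (h : {linear U -> V}) : surjective (@coker_proj R U V h).
Proof. by move=> q; exists (repr q); rewrite coker_projK. Qed.

Lemma coker_proj_eq0 U V (h : {linear U -> V}) v :
  coker_proj h v = 0 <-> exists u, h u = v.
Proof.
rewrite -[0](linear0 (@coker_proj R U V h)); split.
  by move/coker_proj_eq => [u]; rewrite subr0; exists u.
by move=> [u hu]; apply/coker_proj_eq; exists u; rewrite subr0.
Qed.

Lemma short_exact_coker U V (i : {linear U -> V}) :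
  injective i -> short_exact i (coker_proj i : {linear V -> Coker i}).
Proof.
by split=> //; [move=> v; exact: coker_proj_eq0|exact: coker_proj_surjective].
Qed.

Lemma Ker_val U V (p : {linear U -> V}) (k : Ker p) : p (val k) = 0.
Proof. by apply/eqP; exact: (valP k). Qed.

Lemma Ker_ex U V (p : {linear U -> V}) u : p u = 0 -> exists k : Ker p, val k = u.
Proof.
move=> pu; have pu' : kernel_pred p u by apply/eqP.
by exists (exist _ u pu').
Qed.

Lemma short_exact_Ker U V (p : {linear U -> V}) :
  surjective p -> short_exact (val : {linear Ker p -> U}) p.
Proof.
split=> // [|v]; first exact: val_inj.
by split=> [/Ker_ex//|[u <-]]; exact: Ker_val.
Qed.

Lemma short_exact_comp0 U V W (i : {linear U -> V}) (p : {linear V -> W}) u :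
  short_exact i p -> p (i u) = 0.
Proof. by case=> _ ip _; apply/ip; exists u. Qed.

Lemma isomorphic_refl U : isomorphic U U.
Proof. by exists (idfun : {linear U -> U}); exists idfun. Qed.

Lemma isomorphic_sym U V : isomorphic U V -> isomorphic V U.
Proof.
move=> [h [k hK kK]]; have [|k' k'E] := @linear_map V U k.
  by move=> a v w; rewrite -{1}[v]kK -{1}[w]kK -linearP hK.
by exists k', h => v; rewrite k'E.
Qed.

Lemma isomorphic_trans U V W : isomorphic U V -> isomorphic V W -> isomorphic U W.
Proof. by move=> [h hb] [k kb]; exists (k \o h : {linear U -> W}); exact: bij_comp. Qed.

Lemma inj_surj_bij U V (h : {linear U -> V}) : injective h -> surjective h -> bijective h.
Proof.
move=> hi hs; pose k v := sval (cid (hs v)).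
have kK v : h (k v) = v by rewrite /k; case: cid.
by exists k => // u; apply: hi; rewrite kK.
Qed.

Lemma isomorphic_Coker U V W (i : {linear U -> V}) (p : {linear V -> W}) :
  short_exact i p -> isomorphic (Coker i) W.
Proof.
move=> se; have [ii ip ps] := se.
have [|k kE] := @factor_through_epi _ _ W (coker_proj i) p (@coker_proj_surjective _ _ i).
  by move=> v /coker_proj_eq0 /ip.
exists k; apply: inj_surj_bij => [|w].
  apply: linear_inj => q; have [v <-] := @coker_proj_surjective _ _ i q.
  by rewrite kE => /ip/coker_proj_eq0.
by have [v <-] := ps w; exists (coker_proj i v); rewrite kE.
Qed.

Lemma isomorphic_Ker U V W (i : {linear U -> V}) (p : {linear V -> W}) :
  short_exact i p -> isomorphic U (Ker p).
Proof.
move=> se; have [ii ip ps] := se.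
have [|k kE] := @factor_through_mono _ _ U (val : {linear Ker p -> V}) i val_inj.
  by move=> u; apply/Ker_ex/ip; exists u.
exists k; apply: inj_surj_bij => [u u' e|q].
  by apply: ii; rewrite -!kE e.
have /ip[u hu] := Ker_val q.
by exists u; apply: val_inj; rewrite kE.
Qed.

(** [Q] is the cokernel of [a |-> (h a, - i a)] into [Z * C]; injectivity of [i] makes [j]
    injective, and [p] on the second factor induces [q]. *)
Lemma short_exact_pushout A C E Z (i : {linear A -> C}) (p : {linear C -> E})
    (h : {linear A -> Z}) : short_exact i p ->
  exists (Q : lmodType R) (j : {linear Z -> Q}) (q : {linear Q -> E}) (k : {linear C -> Q}),
    [/\ short_exact j q, forall a, k (i a) = j (h a) & forall b, q (k b) = p b].
Proof.
move=> se; have [ii ip ps] := se.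
have [d dE] := @linear_map A (Z * C)%type (fun a => (h a, - i a))
  ltac:(by move=> a x y /=; rewrite /= !linearP).
pose pr := coker_proj d : {linear (Z * C)%type -> Coker d}.
have [j jE] := @linear_map Z (Coker d) (fun z => pr (z, 0))
  ltac:(by move=> a x y /=; rewrite -linearP; congr (pr (_, _)); rewrite /= scaler0 addr0).
have [k kE] := @linear_map C (Coker d) (fun z => pr (0, z))
  ltac:(by move=> a x y /=; rewrite -linearP; congr (pr (_, _)); rewrite /= scaler0 addr0).
have [q qE] := @factor_through_epi _ _ E pr ((p \o snd) : {linear (Z * C)%type -> E})
  (@coker_proj_surjective _ _ d)
  ltac:(by move=> u /coker_proj_eq0 [a <-]; rewrite dE /= linearN (short_exact_comp0 _ se) oppr0).
exists (Coker d), j, q, k; split; last 2 first.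
- move=> a; apply/subr0_eq; rewrite kE jE -linearB; apply/coker_proj_eq0; exists (- a).
  by rewrite dE !linearN opprK; congr pair; rewrite /= ?add0r ?subr0.
- by move=> b; rewrite kE qE.
split=> [|x|e]; last by have [b <-] := ps e; exists (k b); rewrite kE qE.
  apply: linear_inj => z; rewrite jE => /coker_proj_eq0 [a].
  by rewrite dE => -[<- /eqP]; rewrite oppr_eq0 => /eqP ia; rewrite (ii a 0) ?linear0.
have [[z b] <-] := @coker_proj_surjective _ _ d x; rewrite -/pr qE /=; split.
  move=> /ip[a ia]; exists (z + h a); rewrite jE; apply/coker_proj_eq; exists a.
  by rewrite dE -ia; congr pair => /=; rewrite ?sub0r // addrC addKr.
move=> [z' /=]; rewrite jE => /coker_proj_eq[a]; rewrite dE => -[_ e].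
apply/ip; exists a; apply/eqP; rewrite -eqr_opp; apply/eqP.
by rewrite e /= sub0r.
Qed.

(** [Q] is the kernel of [(x, z) |-> p x - h z] on [C * Z], and [j] embeds [A] as the pairs
    [(i a, 0)]. *)
Lemma short_exact_pullback A C E Z (i : {linear A -> C}) (p : {linear C -> E})
    (h : {linear Z -> E}) : short_exact i p ->
  exists (Q : lmodType R) (j : {linear A -> Q}) (q : {linear Q -> Z}) (k : {linear Q -> C}),
    [/\ short_exact j q, forall a, k (j a) = i a & forall x, h (q x) = p (k x)].
Proof.
move=> se; have [ii ip ps] := se.
have [d dE] := @linear_map (C * Z)%type E (fun x => p x.1 - h x.2)
  ltac:(by move=> a x y /=; rewrite /= !linearP /= scalerDr addrACA).
pose v : {linear Ker d -> (C * Z)%type} := (val : {linear Ker d -> (C * Z)%type}).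
have [l lE] := @linear_map A (C * Z)%type (fun a => (i a, 0))
  ltac:(by move=> a x y /=; rewrite linearP; congr pair => /=; rewrite scaler0 addr0).
have [j jE] := @factor_through_mono _ _ A v l (val_inj)
  ltac:(by move=> a; apply: Ker_ex; rewrite dE lE /= (short_exact_comp0 _ se) linear0 subr0).
have {}jE a : val (j a) = (i a, 0) by rewrite -lE -jE.
exists (Ker d), j, (snd \o v : {linear Ker d -> Z}), (fst \o v : {linear Ker d -> C}).
split; last 2 first.
- by move=> a /=; rewrite jE.
- by move=> x /=; apply/esym/subr0_eq; rewrite -dE; exact: Ker_val.
split=> [a a' e|x|z].
- by apply: ii; have := congr1 val e; rewrite !jE => -[].
- split=> /= [x0|[a <-]]; last by rewrite jE.
  have := Ker_val x; rewrite dE x0 linear0 subr0 => /ip[a ia].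
  exists a; apply: val_inj; by rewrite jE ia [RHS]surjective_pairing -x0.
have [c cz] := ps (h z).
by have [|x xE] := @Ker_ex _ _ d (c, z); [rewrite dE /= cz subrr|exists x; rewrite /= xE].
Qed.

(** Third isomorphism theorem: for Z inside Z' inside D, the quotient D/Z is an extension of D/Z' by
    Z'/Z. *)
Lemma short_exact_coker_comp Z Z' D C C'
    (i : {linear Z -> Z'}) (p : {linear Z' -> C}) (j : {linear Z' -> D})
    (q : {linear D -> C'}) : short_exact i p -> short_exact j q ->
  injective (j \o i) /\
  exists (i' : {linear C -> Coker (j \o i : {linear Z -> D})})
         (p' : {linear Coker (j \o i : {linear Z -> D}) -> C'}),
    short_exact i' p' /\ forall d, p' (coker_proj _ d) = q d.
Proof.
move=> seip sejq; have [ii ip ps] := seip; have [ji jq qs] := sejq.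
set d : {linear Z -> D} := (j \o i : {linear Z -> D}).
split; first exact: inj_comp.
have [|i' i'E] := @factor_through_epi _ _ _ p (coker_proj d \o j : {linear Z' -> Coker d}) ps.
  by move=> z /ip[x <-]; apply/coker_proj_eq0; exists x.
have [|p' p'E] := @factor_through_epi _ _ _ (coker_proj d) q (@coker_proj_surjective _ _ d).
  by move=> x /coker_proj_eq0[z <-]; apply/jq; exists (i z).
exists i', p'; split=> //; split=> [|x|c]; last first.
- by have [x <-] := qs c; exists (coker_proj d x); rewrite p'E.
- have [y <-] := @coker_proj_surjective _ _ d x; rewrite p'E; split.
    by move=> /jq[z <-]; exists (p z); rewrite i'E.
  move=> [c]; have [z <-] := ps c; rewrite i'E => /coker_proj_eq[w /= e].
  have -> : y = j (z - i w) by rewrite linearB e opprB addrC subrK.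
  by apply/jq; exists (z - i w).
apply: linear_inj => c; have [z <-] := ps c; rewrite i'E => /coker_proj_eq0[w /= /ji e].
by apply/ip; exists w.
Qed.

(** The preimage of [K] under [q] is the kernel of the composite, and it is an extension of [K] by
    [K']. *)
Lemma short_exact_ker_comp Z Z' D K K'
    (i : {linear K -> Z'}) (p : {linear Z' -> Z}) (j : {linear K' -> D})
    (q : {linear D -> Z'}) : short_exact i p -> short_exact j q ->
  surjective (p \o q) /\
  exists (i' : {linear K' -> Ker (p \o q : {linear D -> Z})})
         (p' : {linear Ker (p \o q : {linear D -> Z}) -> K}),
    short_exact i' p' /\ forall k, val (i' k) = j k.
Proof.
move=> seip sejq; have [ii ip ps] := seip; have [ji jq qs] := sejq.
set d : {linear D -> Z} := (p \o q : {linear D -> Z}).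
split; first by move=> z; have [y <-] := ps z; have [x <-] := qs y; exists x.
pose v : {linear Ker d -> D} := (val : {linear Ker d -> D}).
have [|i' i'E] := @factor_through_mono _ _ _ v j val_inj.
  by move=> k; apply: Ker_ex; rewrite /d /= (short_exact_comp0 _ sejq) linear0.
have [|p' p'E] := @factor_through_mono _ _ _ i (q \o v : {linear Ker d -> Z'}) ii.
  by move=> x; apply/ip; exact: (Ker_val x).
have {}i'E k : val (i' k) = j k by rewrite -i'E.
exists i', p'; split=> //; split=> [x y e|x|k].
- by apply: ji; rewrite -!i'E e.
- split=> [x0|[k <-]].
    have /jq[k kE] : q (v x) = 0 by rewrite -[LHS]p'E x0 linear0.
    by exists k; apply: val_inj; rewrite i'E.
  by apply: ii; rewrite p'E /= linear0 i'E (short_exact_comp0 _ sejq).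
have [x xE] := qs (i k).
have [|y yE] := @Ker_ex _ _ d x; first by rewrite /d /= xE (short_exact_comp0 _ seip).
by exists y; apply: ii; rewrite p'E /= yE.
Qed.

Lemma section_of_retraction U V W (i : {linear U -> V}) (p : {linear V -> W})
    (r : {linear V -> U}) : short_exact i p -> (forall u, r (i u) = u) ->
  exists s : {linear W -> V}, forall w, p (s w) = w.
Proof.
move=> se ri; have [ii ip ps] := se.
have [h hE] := @linear_map V V (fun v => v - i (r v))
  ltac:(by move=> a x y; rewrite /= !linearP /= scalerDr addrACA).
have [|s sE] := @factor_through_epi _ _ _ p h ps.
  by move=> v /ip[u <-]; rewrite hE ri subrr.
by exists s => w; have [v <-] := ps w; rewrite sE hE linearB (short_exact_comp0 _ se) subr0.
Qed.

Lemma retraction_of_section U V W (i : {linear U -> V}) (p : {linear V -> W})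
    (s : {linear W -> V}) : short_exact i p -> (forall w, p (s w) = w) ->
  exists r : {linear V -> U}, forall u, r (i u) = u.
Proof.
move=> se ps'; have [ii ip ps] := se.
have [h hE] := @linear_map V V (fun v => v - s (p v))
  ltac:(by move=> a x y; rewrite /= !linearP /= scalerDr addrACA).
have [|r rE] := @factor_through_mono _ _ _ i h ii.
  by move=> v; apply/ip; rewrite hE linearB ps' subrr.
by exists r => u; apply: ii; rewrite rE hE (short_exact_comp0 _ se) linear0 subr0.
Qed.
End Exactness.

(** * Transport along isomorphisms, the short five lemma and factorizations *)

Section ExactDiagrams.
Context (R : pzRingType).
Implicit Types U V W A E C K Q Z : lmodType R.

Lemma isomorphic_inverse U V : isomorphic U V ->
  exists (h : {linear U -> V}) (k : {linear V -> U}), cancel h k /\ cancel k h.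
Proof.
move=> [h [k hK kK]]; have [|k' k'E] := @linear_map R V U k.
  by move=> a v w; rewrite -{1}[v]kK -{1}[w]kK -linearP hK.
by exists h, k'; split=> x; rewrite k'E.
Qed.

Lemma short_exact_isomorphic A A' E E' C C' (i : {linear A -> E}) (p : {linear E -> C}) :
    isomorphic A A' -> isomorphic E E' -> isomorphic C C' -> short_exact i p ->
  exists (i' : {linear A' -> E'}) (p' : {linear E' -> C'}), short_exact i' p'.
Proof.
move=> /isomorphic_sym[h hb] /isomorphic_inverse[k [k' [kK k'K]]] [l lb] [ii ip ps].
have [h' hK h'K] := hb; have [l' lK l'K] := lb.
exists (k \o (i \o h) : {linear _ -> _}), (l \o (p \o k') : {linear _ -> _}); split=> [x y|x|y] /=.
- by move/(can_inj kK)/ii/(bij_inj hb).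
- split=> [x0|[a <-]]; last first.
    by rewrite kK; have -> : p (i (h a)) = 0; [apply/ip; exists (h a)|rewrite linear0].
  have /ip[a aE] : p (k' x) = 0 by apply: (can_inj lK); rewrite x0 linear0.
  by exists (h' a); rewrite h'K aE k'K.
by have [x xE] := ps (l' y); exists (k x); rewrite kK xE l'K.
Qed.

Lemma short_five A E C A' E' C' (i : {linear A -> E}) (p : {linear E -> C})
    (i' : {linear A' -> E'}) (p' : {linear E' -> C'})
    (a : A -> A') (e : {linear E -> E'}) (x : {linear C -> C'}) :
    short_exact i p -> short_exact i' p' -> bijective a -> bijective x ->
    (forall u, e (i u) = i' (a u)) -> (forall u, p' (e u) = x (p u)) ->
  bijective e.
Proof.
move=> se se' [a' aK a'K] xb ei pe.
have [ii ip ps] := se; have [ii' ip' ps'] := se'; have [x' xK x'K] := xb.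
apply: inj_surj_bij => [|v].
  apply: linear_inj => u eu.
  have /ip[w wu] : p u = 0 by apply: (can_inj xK); rewrite -pe eu !linear0.
  have : a w = a 0 by apply: ii'; rewrite -!ei wu eu !linear0.
  by move/(can_inj aK) => w0; rewrite -wu w0 linear0.
have [u uE] := ps (x' (p' v)).
have /ip'[w wE] : p' (v - e u) = 0 by rewrite linearB pe uE x'K subrr.
by exists (i (a' w) + u); rewrite linearD ei a'K wE subrK.
Qed.

(** A map of short exact sequences with the same right end is a pushout square, so [k] inherits
    injectivity and the cokernel from [h]. Concretely, [Q] is the quotient of [Z * E] by the pairs
    [(- h a, i a)], and [r] on the first factor vanishes on these. *)
Lemma short_exact_pushout_coker A E C Z Q W (i : {linear A -> E}) (p : {linear E -> C})
    (j : {linear Z -> Q}) (q : {linear Q -> C}) (h : {linear A -> Z}) (r : {linear Z -> W})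
    (k : {linear E -> Q}) :
    short_exact i p -> short_exact j q -> short_exact h r ->
    (forall a, k (i a) = j (h a)) -> (forall b, q (k b) = p b) ->
  exists r' : {linear Q -> W}, short_exact k r'.
Proof.
move=> se se' [hi hr rs] ki qk; have [ii ip ps] := se; have [ji jq qs] := se'.
have [s sE] := @linear_map R (Z * E)%type Q (fun z => j z.1 + k z.2)
  ltac:(by move=> a x y; rewrite /= !linearP /= scalerDr addrACA).
have ss : surjective s.
  move=> x; have [b bE] := ps (q x).
  have /jq[z zE] : q (x - k b) = 0 by rewrite linearB qk bE subrr.
  by exists (z, b); rewrite sE /= zE subrK.
have s0 z b : s (z, b) = 0 -> exists2 a, i a = b & h a = - z.
  rewrite sE /= => e; have /ip[a aE] : p b = 0.
    by rewrite -qk; move: (congr1 q e); rewrite linearD linear0 (short_exact_comp0 _ se') add0r.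
  exists a => //; apply: ji; rewrite -ki aE linearN; apply/eqP.
  by rewrite -addr_eq0 addrC e.
have [|r' rE] := @factor_through_epi _ _ _ _ s (r \o fst : {linear (Z * E)%type -> W}) ss.
  move=> [z b] /s0[a _ ha] /=; apply/hr; exists (- a).
  by rewrite linearN ha opprK.
exists r'; split=> [|x|w]; last first.
- by have [z <-] := rs w; exists (s (z, 0)); rewrite rE.
- have [[z b] <-] := ss x; rewrite rE /=; split=> [/hr[a ha]|[b' bE]].
    by exists (i a + b); rewrite linearD ki ha sE.
  have [|a _ ha] := s0 z (b - b').
    by rewrite sE /= linearB bE sE /= opprD [- j z - _]addrC addrA addrA addrK subrr.
  by apply/hr; exists (- a); rewrite linearN ha opprK.
apply: linear_inj => b kb; have [|a <- ha] := s0 0 b; first by rewrite sE /= kb linear0 addr0.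
by rewrite (hi a 0) ?linear0 // ha oppr0.
Qed.

(* With [C0 -> V] epi and [C0] in [C], the map [U x C0 -> V] is epi; pushing its
   kernel out along an embedding into an object of [D] gives [F]. *)
Lemma complete_pair_factor (C D : lmodType R -> Prop) :
    (forall K U W (i : {linear K -> U}) (p : {linear U -> W}),
       short_exact i p -> C K -> C W -> C U) -> complete_pair C D ->
  forall U V (h : {linear U -> V}),
  exists (F C1 D1 : lmodType R) (i : {linear U -> F}) (pi : {linear F -> C1})
         (j : {linear D1 -> F}) (p : {linear F -> V}),
    [/\ C C1 /\ D D1, short_exact i pi, short_exact j p & forall u, p (i u) = h u].
Proof.
move=> Cext cpl U V h; have [[D0 [C0 [i0 [p0 [C0C _ se0]]]]] _] := cpl V.
have [s sE] := @linear_map R (U * C0)%type V (fun z => h z.1 + p0 z.2)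
  ltac:(by move=> a x y; rewrite /= !linearP /= scalerDr addrACA).
have ss : surjective s.
  by case: se0 => _ _ ps v; have [x <-] := ps v; exists (0, x); rewrite sE /= linear0 add0r.
have [_ [D1 [C1 [i1 [p1 [C1C D1D se1]]]]]] := cpl (Ker s).
have [F [j [q [k [se kj qk]]]]] := short_exact_pushout i1 (short_exact_Ker ss).
have [r ser] := short_exact_pushout_coker (short_exact_Ker ss) se se1 kj qk.
have [l lE] := @linear_map R U (U * C0)%type (fun u => (u, 0))
  ltac:(by move=> a x y; congr pair; rewrite /= scaler0 addr0).
have sel : short_exact l (snd : {linear (U * C0)%type -> C0}).
  split=> [u u'|[u x]|x]; [by rewrite !lE => -[]| |by exists (0, x)].
  by split=> /= [->|[u']]; [exists u; rewrite lE|rewrite lE => -[_ <-]].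
(* The cokernel of the composite U -> U x C0 -> F is an extension of [C1] by [C0], hence lies in [C]
   by closure under extensions. *)
have [kl [i' [p' [se' _]]]] := short_exact_coker_comp sel ser.
exists F, (Coker (k \o l : {linear U -> F})), D1, (k \o l : {linear U -> F}),
  (coker_proj _ : {linear _ -> _}), j, q; split=> //.
- by split=> //; exact: Cext se' C0C C1C.
- exact: short_exact_coker.
by move=> u; rewrite /= qk lE sE /= linear0 addr0.
Qed.
End ExactDiagrams.

(** * Free modules and projective resolutions *)

(* [int] acts on the right, so that [tensor (regular_Rint R) {freeg S}] is the
   free [R]-module on [S] *)
Definition regular_Rint (R : pzRingType) : Type := R^o.
HB.instance Definition _ (R : pzRingType) := GRing.Lmodule.on (regular_Rint R).

Section RegularRint.
Context (R : pzRingType).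
Implicit Types (r s : regular_Rint R) (a b : int).
Let act r a : regular_Rint R := r *~ a.
Let actDl a : {morph act^~ a : r s / r + s}. Proof. by move=> r s; exact: mulrzDl. Qed.
Let actDr r : {morph act r : a b / a + b}. Proof. by move=> a b; exact: mulrzDr. Qed.
Let actA r a b : act r (a * b) = act (act r a) b. Proof. exact: mulrzA. Qed.
Let act1 r : act r 1 = r. Proof. by []. Qed.
Let actZl (x : R) r a : act (x *: r) a = x *: act r a. Proof. by rewrite /act scalerMzr. Qed.
HB.instance Definition _ := Lmodule_isBimodule.Build R int (regular_Rint R) actDl actDr actA act1 actZl.
End RegularRint.

Lemma tensor_linear (A B : pzRingType) (M : bimodType B A) (X : lmodType A) (Z : lmodType B)
    (beta : M -> X -> Z) :
    balanced beta -> (forall b m x, beta (b *: m) x = b *: beta m x) ->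
  exists h : {linear tensor M X -> Z}, forall m x, h (tens m x) = beta m x.
Proof.
move=> bb bZ; have hE := tensor_liftE bb; have hB := tensor_lift_additive bb.
pose H : {additive tensor M X -> Z} :=
  HB.pack (tensor_lift beta) (GRing.isZmodMorphism.Build _ _ _ hB).
have [|h hE'] := @linear_map B (tensor M X) Z H.
  move=> b t u; rewrite raddfD; congr (_ + _).
  elim/tensor_ind: t => [|m x t IH]; first by rewrite !(scaler0, raddf0).
  by rewrite !(scalerDr, raddfD) IH tensZ /= !hE bZ.
by exists h => m x; rewrite hE' /= hE.
Qed.

Section Free.
Context (R : pzRingType).
Implicit Types (U V W X Y : lmodType R).

Definition free (S : choiceType) : lmodType R := tensor (regular_Rint R) {freeg S}.
Definition free_gen (S : choiceType) (s : S) : free S := tens (1 : regular_Rint R) << s >>.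

Lemma free_lift (S : choiceType) U (f : S -> U) :
  exists h : {linear free S -> U}, forall s, h (free_gen s) = f s.
Proof.
pose F : {freeg S} -> zmodule U := fglift (f : S -> zmodule U).
have FB : zmod_morphism F by exact: lift_is_additive.
pose FA : {additive {freeg S} -> zmodule U} := HB.pack F (GRing.isZmodMorphism.Build _ _ _ FB).
have [||h hE] := @tensor_linear int R (regular_Rint R) {freeg S} U
  (fun r g => (r : R) *: (FA g : U)).
- split=> [m m' x|m x x'|m a x]; first by rewrite scalerDl.
    by rewrite raddfD scalerDr.
  have -> : a *: x = x *~ a by rewrite -{1}[a]intz scaler_int.
  by rewrite [ract _ _]/(m *~ a) raddfMz -scalerMzr -scalerMzl.
- by move=> b m x; rewrite scalerA.
exists h => s; rewrite /free_gen hE /= /F liftU !scale1r //.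
Qed.

Lemma free_ext (S : choiceType) U (h k : {linear free S -> U}) :
  (forall s, h (free_gen s) = k (free_gen s)) -> h =1 k.
Proof.
move=> hk; apply: tensor_ext => [x y|x y|m x]; rewrite ?linearB //.
have [d dE] := @linear_map R (free S) U (fun t => h t - k t)
  ltac:(by move=> a u v; rewrite /= !linearP /= scalerDr addrACA).
apply/subr0_eq; rewrite -dE.
have -> : tens m x = (m : R) *: tens (1 : regular_Rint R) x.
  by rewrite tensZ; congr tens; rewrite /GRing.scale /= mulr1.
rewrite linearZ /=.
have tB : zmod_morphism (fun x => tens (1 : regular_Rint R) x : free S).
  move=> u v; apply/eqP; rewrite eq_sym subr_eq -tensDr subrK //.
pose tA : {additive {freeg S} -> free S} := HB.pack (fun x => tens (1 : regular_Rint R) x : free S)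
  (GRing.isZmodMorphism.Build _ _ _ tB).
suff -> : d (tA x) = 0 by rewrite scaler0.
rewrite -[x]freeg_sumE !raddf_sum big1_seq // => s _.
rewrite -[coeff _ _]intz -freegU_mulz !raddfMz /= -/(free_gen s) dE hk subrr.
by rewrite mul0rz.
Qed.

Lemma free_projective (S : choiceType) : projective (free S).
Proof.
move=> U V p h ps.
have [k kE] := @free_lift S U (fun s => sval (cid (ps (h (free_gen s))))).
exists k; apply: (free_ext (h := p \o k : {linear _ -> _})) => s /=.
by rewrite kE; case: cid.
Qed.

Definition free_cover X : {linear free X -> X} := sval (cid (@free_lift X X id)).

Lemma free_cover_surjective X : surjective (free_cover X).
Proof. by move=> x; exists (free_gen x); rewrite /free_cover; case: cid => h /= ->. Qed.

(** Each stage of a resolution is built on the kernel of the preceding map, so the recursion has to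
    carry a map together with its source and target. *)
Record arrow := Arrow { asrc : lmodType R; atgt : lmodType R; amap : {linear asrc -> atgt} }.

Definition arrow_syzygy (d : arrow) : arrow :=
  Arrow ((val : {linear Ker (amap d) -> asrc d}) \o free_cover (Ker (amap d)) : {linear _ -> _}).

(** Stage 0 is the augmentation; the target of stage [n.+1] is by computation the source of stage
    [n], so the stages from 1 on are the differentials. *)
Fixpoint free_complex X n : arrow :=
  if n is m.+1 then arrow_syzygy (free_complex X m) else Arrow (free_cover X).

Lemma arrow_syzygy_exact (d : arrow) : exact_at (amap (arrow_syzygy d)) (amap d).
Proof.
move=> v; split=> [/Ker_ex[k <-]|[u <-]]; last exact: Ker_val.
by have [u <-] := @free_cover_surjective _ k; exists u.
Qed.

Lemma projective_resolution_exists X : inhabited (projective_resolution X).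
Proof.
constructor; apply: (@ProjectiveResolution R X (fun n => asrc (free_complex X n))
  (fun n => amap (free_complex X n.+1)) (free_cover X)).
- by case=> [|n]; exact: free_projective.
- exact: free_cover_surjective.
- exact (@arrow_syzygy_exact (free_complex X 0)).
- by move=> n; exact (@arrow_syzygy_exact (free_complex X n.+1)).
Qed.
End Free.

(** * Vanishing of Ext as splitting, extension and lifting *)

Section Ext.
Context (R : pzRingType).
Implicit Types U V W A C D E K X Y Z : lmodType R.

(** Lift the augmentation of a resolution [P] of [C] to [u : P0 -> E]; it restricts to
    [v : P1 -> A], and [h \o v] is a cocycle, hence equals [k] after the differential. As [E] is the
    quotient of [P0 * A] by the pairs [(d z, - v z)], the map given by [k] and [h] descends to
    it. *)
Lemma ext_extend C Y A E (i : {linear A -> E}) (p : {linear E -> C}) (h : {linear A -> Y}) :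
    Ext1_eq0 C Y -> short_exact i p ->
  exists k : {linear E -> Y}, forall a, k (i a) = h a.
Proof.
move=> ext se; have [ii ip ps] := se.
have [P] := projective_resolution_exists C.
have [u uE] := @res_projective _ _ P 0 _ _ p (res_aug P) ps.
have d0 x : res_aug P (res_diff P 0 x) = 0 by apply/(@res_exact0 _ _ P); exists x.
have d1 x : res_diff P 0 (res_diff P 1 x) = 0 by apply/(@res_exactS _ _ P 0); exists x.
have [|v vE] := @factor_through_mono _ _ _ _ i (u \o res_diff P 0 : {linear _ -> _}) ii.
  by move=> x; apply/ip; rewrite /= uE d0.
have [|k kE] := ext P (h \o v : {linear _ -> _}).
  move=> x /=; suff -> : v (res_diff P 1 x) = 0 by rewrite linear0.
  by apply: ii; rewrite vE /= d1 !linear0.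
have [s sE] := @linear_map R (res_obj P 0 * A)%type E (fun z => u z.1 + i z.2)
  ltac:(by move=> a x y; rewrite /= !linearP /= scalerDr addrACA).
have [t tE] := @linear_map R (res_obj P 0 * A)%type Y (fun z => k z.1 + h z.2)
  ltac:(by move=> a x y; rewrite /= !linearP /= scalerDr addrACA).
have [||l lE] := @factor_through_epi _ _ _ _ s t.
- move=> e; have [x xE] := @res_aug_surjective _ _ P (p e).
  have /ip[a aE] : p (e - u x) = 0 by rewrite linearB uE xE subrr.
  by exists (x, a); rewrite sE /= aE addrC subrK.
- move=> [x a]; rewrite sE tE /= => e.
  have /(@res_exact0 _ _ P)[z zx] : res_aug P x = 0.
    by move: (congr1 p e); rewrite linearD linear0 (short_exact_comp0 _ se) addr0 uE.
  have -> : a = - v z.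
    by apply: ii; rewrite linearN vE /= zx; apply/eqP; rewrite -addr_eq0 addrC e.
  by rewrite -zx -kE linearN subrr.
by exists l => a; have := lE (0, a); rewrite sE tE /= !linear0 !add0r.
Qed.

(** A cocycle on [P1] descends to [g] on the kernel [K] of the augmentation. Pushing out 0 -> K ->
    P0 -> C -> 0 along [g] gives an extension of [C] by [Y], and a retraction of it extends [g] to
    [P0]. *)
Lemma split_ext C Y :
    (forall E (i : {linear Y -> E}) (p : {linear E -> C}), short_exact i p ->
      exists s : {linear C -> E}, forall x, p (s x) = x) ->
  Ext1_eq0 C Y.
Proof.
move=> spl P h h0.
pose L := res_obj P 0; pose K := Ker (res_aug P); pose v : {linear K -> L} := val.
have d0 x : res_aug P (res_diff P 0 x) = 0 by apply/(@res_exact0 _ _ P); exists x.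
have [|q qE] := @factor_through_mono _ _ _ _ v (res_diff P 0) val_inj.
  by move=> x; exact: Ker_ex.
have [||g gE] := @factor_through_epi _ _ _ _ q h.
- move=> k; have /(@res_exact0 _ _ P)[x xk] := Ker_val k.
  by exists x; apply: val_inj; rewrite [LHS]qE xk.
- move=> x qx; have /(@res_exactS _ _ P 0)[y <-] : res_diff P 0 x = 0 by rewrite -qE qx linear0.
  exact: h0.
have se : short_exact v (res_aug P) by apply: short_exact_Ker; exact: res_aug_surjective.
have [E [j [p [k [se' kj _]]]]] := short_exact_pushout g se.
have [s sE] := spl _ _ _ se'; have [r rE] := retraction_of_section se' sE.
by exists (r \o k : {linear _ -> _}) => x; rewrite /= -gE -qE kj rE.
Qed.

(** The pullback along [h] is an extension of [C] by [Y]; a section of it, followed by the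
    projection to [A], is the lift. *)
Lemma ext_lift C Y A E (i : {linear Y -> A}) (p : {linear A -> E}) (h : {linear C -> E}) :
    Ext1_eq0 C Y -> short_exact i p ->
  exists k : {linear C -> A}, forall c, p (k c) = h c.
Proof.
move=> ext se; have [Q [j [q [k [se' kj qk]]]]] := short_exact_pullback h se.
have [r rE] := ext_extend (idfun : {linear Y -> Y}) ext se'.
have [s sE] := section_of_retraction se' rE.
by exists (k \o s : {linear _ -> _}) => c /=; rewrite -qk sE.
Qed.

Lemma short_exact_iso_l A A' E C (i : {linear A -> E}) (p : {linear E -> C}) (h : {linear A' -> A}) :
  bijective h -> short_exact i p -> short_exact (i \o h) p.
Proof.
move=> [k hK kK] [ii ip ps]; split=> // [|e]; first by apply: inj_comp => //; exact: can_inj hK.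
by split=> [/ip[a <-]|[a <-]]; [exists (k a); rewrite /= kK|apply/ip; exists (h a)].
Qed.

Lemma short_exact_iso_r A E C C' (i : {linear A -> E}) (p : {linear E -> C}) (h : {linear C -> C'}) :
  bijective h -> short_exact i p -> short_exact i (h \o p).
Proof.
move=> hb [ii ip ps]; have [k hK kK] := hb; split=> // [e|c].
  split=> [/= e0|/ip/= ->]; last by rewrite linear0.
  by apply/ip; apply: (can_inj hK); rewrite e0 linear0.
by have [e eE] := ps (k c); exists e; rewrite /= eE kK.
Qed.

Lemma ext_iso C C' Y Y' : isomorphic C C' -> isomorphic Y Y' -> Ext1_eq0 C Y -> Ext1_eq0 C' Y'.
Proof.
move=> /isomorphic_sym[h hb] [k kb] ext; apply: split_ext => E i p se.
have se' := short_exact_iso_r hb (short_exact_iso_l kb se).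
have [l hl lh] := hb.
have [s sE] := ext_lift (idfun : {linear C -> C}) ext se'.
exists (s \o h : {linear _ -> _}) => x.
by apply: (can_inj hl); exact: (sE (h x)).
Qed.

(** An extension of [W] by [Y] is retracted in two stages: first on the preimage of [K], then from
    there to the whole module, the quotient being [C]. *)
Lemma ext_extl K W C Y (i : {linear K -> W}) (p : {linear W -> C}) : short_exact i p ->
  Ext1_eq0 K Y -> Ext1_eq0 C Y -> Ext1_eq0 W Y.
Proof.
move=> se extK extC; apply: split_ext => E j q se'.
have [ps [i' [p' [se'' i'E]]]] := short_exact_ker_comp se se'.
have [r rE] := ext_extend (idfun : {linear Y -> Y}) extK se''.
have [r' r'E] := ext_extend r extC (short_exact_Ker ps).
apply: (section_of_retraction (r := r') se') => y.
by rewrite -i'E [LHS]r'E rE.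
Qed.

(** Dually, an extension of [Y] by [W] is split first modulo [K], and the section is then lifted
    along the quotient by [K]. *)
Lemma ext_extr K W C Y (i : {linear K -> W}) (p : {linear W -> C}) : short_exact i p ->
  Ext1_eq0 Y K -> Ext1_eq0 Y C -> Ext1_eq0 Y W.
Proof.
move=> se extK extC; apply: split_ext => E j q se'.
have [ii [i' [p' [se'' p'E]]]] := short_exact_coker_comp se se'.
have [s sE] := ext_lift (idfun : {linear Y -> Y}) extC se''.
have [s' s'E] := ext_lift s extK (short_exact_coker ii).
by exists s' => y; rewrite -p'E [X in p' X]s'E sE.
Qed.

Lemma ext_projective P Y : projective P -> Ext1_eq0 P Y.
Proof.
move=> pP; apply: split_ext => E i p [_ _ ps].
exact: (pP _ _ p (idfun : {linear P -> P}) ps).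
Qed.

Lemma ext_zero_l C Y : (forall c : C, c = 0) -> Ext1_eq0 C Y.
Proof.
move=> C0; apply: ext_projective => U V p h ps.
have [z zE] := @linear_map R C U (fun=> 0) ltac:(by move=> a x y; rewrite scaler0 addr0).
by exists z => x; rewrite zE (C0 x) !linear0.
Qed.

Lemma ext_zero_r C Y : (forall c : Y, c = 0) -> Ext1_eq0 C Y.
Proof.
move=> Y0; apply: split_ext => E i p se.
have [z zE] := @linear_map R E Y (fun=> 0) ltac:(by move=> a x y; rewrite scaler0 addr0).
by apply: (section_of_retraction (r := z) se) => y; rewrite zE [RHS]Y0.
Qed.

Lemma regular_projective : projective (R^o : lmodType R).
Proof.
move=> U V p h ps; have [u uE] := ps (h (1 : R^o)).
have [k kE] := @linear_map R R^o U (fun r => r *: u)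
  ltac:(by move=> a x y; rewrite scalerDl scalerA).
by exists k => x; rewrite kE linearZ uE -linearZ /= [_ *: _]mulr1.
Qed.

Definition zero_module : lmodType R := Ker (idfun : {linear R^o -> R^o}).
Lemma zero_moduleE (z : zero_module) : z = 0.
Proof. by apply: val_inj; exact: (Ker_val z). Qed.
End Ext.

(** * Injective cogenerators *)

(** Euclidean division by the least positive element. The zero subgroup is kept apart because there
    is then no positive generator to divide by. *)
Lemma int_subgroup_principal (P : int -> Prop) :
    P 0 -> (forall a b, P a -> P b -> P (a - b)) ->
  (forall n, P n -> n = 0) \/
  exists m : nat, [/\ (0 < m)%N, P m & forall n, P n -> exists q, n = m%:Z * q].
Proof.
move=> P0 PB; have PN a : P a -> P (- a) by rewrite -[- a]sub0r; exact: PB.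
have Pabs a : P a -> P (absz a)%:Z.
  by move=> Pa; case: (intP a) Pa => // k; rewrite abszN //= => /PN; rewrite opprK.
have [[k [k0 Pk]]|noP] := pselect (exists k : nat, (0 < k)%N /\ P k); last first.
  left=> n /Pabs Pn; apply/eqP; rewrite -absz_eq0 -leqn0 leqNgt; apply/negP => n0.
  by apply: noP; exists (absz n).
right; pose p (k : nat) := (0 < k)%N && `[< P k >].
have [|m /andP[m0 /asboolP Pm] mmin] := @ex_minnP p.
  by exists k; rewrite /p k0; apply/asboolP.
exists m; split=> //.
have PM (q : nat) : P (m%:Z * q%:Z).
  elim: q => [|q IHq]; first by rewrite mulr0.
  by rewrite intS mulrDr mulr1 addrC -[X in _ + X]opprK; apply: PB => //; exact: PN.
have Pnat (n : nat) : P n -> exists q : nat, n%:Z = m%:Z * q%:Z.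
  move=> Pn; exists (n %/ m)%N; have e : n%:Z = m%:Z * (n %/ m)%N%:Z + (n %% m)%N%:Z.
    by rewrite -PoszM -PoszD mulnC -divn_eq.
  rewrite e; suff -> : (n %% m = 0)%N by rewrite addr0.
  apply/eqP; rewrite -leqn0 leqNgt; apply/negP => r0.
  have : p (n %% m)%N.
    rewrite /p r0 /=; apply/asboolP.
    have -> : (n %% m)%N%:Z = n%:Z - m%:Z * (n %/ m)%N by rewrite {1}e addrC addKr.
    exact: PB.
  by move/mmin; rewrite leqNgt ltn_mod m0.
case=> n Pn; first by have [q ->] := Pnat n Pn; exists q%:Z.
by have /Pnat[q e] := PN _ Pn; exists (- q%:Z); rewrite mulrN -e NegzE.
Qed.

Section Divisible.
Context (H D : zmodType).
Implicit Types (G : H -> D -> Prop).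

(* graphs of additive maps from subgroups of [H] to [D] *)
Definition partial_additive G :=
  [/\ G 0 0, forall x y d e, G x d -> G y e -> G (x - y) (d - e)
    & forall d, G 0 d -> d = 0].

Definition divisible := forall (n : nat) (d : D), (0 < n)%N -> exists c, c *+ n = d.

Lemma partial_additive_fun G x d e : partial_additive G -> G x d -> G x e -> d = e.
Proof. by move=> [_ GB G0] gd ge; apply/subr0_eq/G0; rewrite -(subrr x); exact: GB. Qed.

Lemma partial_additiveMz G x d n : partial_additive G -> G x d -> G (x *~ n) (d *~ n).
Proof.
move=> [G0 GB _] gd; have GN y e : G y e -> G (- y) (- e).
  by move=> ge; rewrite -[- y]sub0r -[- e]sub0r; apply: GB.
have Gn (m : nat) : G (x *+ m) (d *+ m).
  elim: m => // m IHm; rewrite !mulrSr -[X in G (_ + X)]opprK -[X in G _ (_ + X)]opprK.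
  by apply: GB => //; exact: GN.
by case: n => m; rewrite ?NegzE ?mulrNz -?pmulrn; [|apply: GN]; exact: Gn.
Qed.

(** The new graph is the sum of [G] and the multiples of [(h, c)]; the condition on the multiples of
    [h] in the domain of [G] is what makes the sum single-valued. *)
Lemma partial_additive_extend1 G h c : partial_additive G ->
    (forall (n : int) e, G (h *~ n) e -> e = c *~ n) ->
  exists G', [/\ partial_additive G', forall x d, G x d -> G' x d & G' h c].
Proof.
move=> [G0 GB Gf] hc.
exists (fun x d => exists (n : int) y e, [/\ G y e, x = y + h *~ n & d = e + c *~ n]).
split; first split.
- by exists 0, 0, 0; rewrite !mulr0z !addr0.
- move=> _ _ _ _ [n [y [e [ge -> ->]]]] [n' [y' [e' [ge' -> ->]]]].
  exists (n - n'), (y - y'), (e - e'); split; first exact: GB.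
    by rewrite mulrzBr opprD addrACA.
  by rewrite mulrzBr opprD addrACA.
- move=> _ [n [y [e [ge /esym/eqP e0 ->]]]]; move: e0 ge; rewrite addr_eq0 => /eqP ->.
  by rewrite -mulrNz => /hc ->; rewrite mulrNz addNr.
- by move=> x d gd; exists 0, x, d; rewrite !mulr0z !addr0.
by exists 1, 0, 0; rewrite !mulr1z !add0r.
Qed.

(** The multiples of [h] in the domain are generated by some [h *~ m], and its value is divided by
    [m]; if only 0 is such a multiple, the value 0 is consistent. *)
Lemma partial_additive_value G h : divisible -> partial_additive G ->
  exists c, forall (n : int) e, G (h *~ n) e -> e = c *~ n.
Proof.
move=> dD Gp; have [G0 GB Gf] := Gp.
have [||P0|[m [m0 [d gd] Pm]]] := @int_subgroup_principal (fun n => exists e, G (h *~ n) e).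
- by exists 0; rewrite mulr0z.
- by move=> a b [d gd] [e ge]; exists (d - e); rewrite mulrzBr; exact: GB.
- exists 0 => n e ge; have n0 := P0 n (ex_intro _ e ge).
  by move: ge; rewrite n0 !mulr0z => /Gf.
have [c cE] := dD m d m0; exists c => n e ge.
have [q nq] := Pm n (ex_intro _ e ge); apply: (partial_additive_fun Gp ge).
by rewrite nq !mulrzA -[c *~ m%:Z]pmulrn cE; exact: partial_additiveMz.
Qed.

(** Divisible groups are injective: Zorn's lemma yields a maximal graph, and one-step extensions
    show that it is total. *)
Lemma additive_extension G0 : divisible -> partial_additive G0 ->
  exists f : H -> D, zmod_morphism f /\ forall x d, G0 x d -> f x = d.
Proof.
move=> dD G0p.
pose T := {G : H -> D -> Prop | partial_additive G /\ forall x d, G0 x d -> G x d}.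
pose t0 : T := exist _ G0 (conj G0p (fun x d => id)).
pose le (s t : T) := `[< forall x d, sval s x d -> sval t x d >].
have lerefl t : le t t by apply/asboolP.
have letrans r s t : le r s -> le s t -> le r t.
  by move=> /asboolP rs /asboolP st; apply/asboolP => x d /rs /st.
(* Maximality for a preorder: any graph above [G] is contained in [G]. A nonempty chain is bounded
   by its union, the empty one by [t0]. *)
have [S Stot|[G [Gp G0G]] Gmax] := ZL_preorder t0 lerefl letrans.
  have [[s0 Ss0]|noS] := pselect (exists s, S s); last first.
    by exists t0 => s Ss; case: noS; exists s.
  pose G x d := exists s, S s /\ sval s x d.
  have Gp : partial_additive G.
    split.
    - by exists s0; split=> //; case: (svalP s0) => -[].
    - move=> x y d e [s [Ss sd]] [t [St te]].
      have [/asboolP st|/asboolP ts] := Stot s t Ss St.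
        by exists t; split=> //; case: (svalP t) => -[_ + _] _; apply=> //; exact: st.
      by exists s; split=> //; case: (svalP s) => -[_ + _] _; apply=> //; exact: ts.
    - by move=> d [s [_ sd]]; case: (svalP s) => -[_ _ +] _; exact.
  have G0G x d : G0 x d -> G x d.
    by move=> g0; exists s0; split=> //; case: (svalP s0) => _; exact.
  by exists (exist _ G (conj Gp G0G)) => s Ss; apply/asboolP => x d sd; exists s.
have Gtot x : exists d, G x d.
  have [c cE] := partial_additive_value x dD Gp.
  have [G' [G'p GG' G'c]] := partial_additive_extend1 Gp cE; exists c.
  pose t' : T := exist _ G' (conj G'p (fun x d g0 => GG' x d (G0G x d g0))).
  have /Gmax/asboolP : le (exist _ G (conj Gp G0G)) t' by apply/asboolP.
  by apply.
pose f x := sval (cid (Gtot x)); have fE x : G x (f x) by rewrite /f; case: cid.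
exists f; split=> [x y|x d g0]; last exact: (partial_additive_fun Gp (fE x) (G0G _ _ g0)).
have [_ GB _] := Gp; apply: (partial_additive_fun Gp (fE _)); exact: GB.
Qed.
End Divisible.

Section QmodZ.

Lemma int_rat_linear : linear ((fun n => n%:~R) : int^o -> zmodule rat).
Proof.
move=> a x y; rewrite intrD intrM; congr (_ + _).
by rewrite -[a in RHS]intz [RHS](scaler_int (V := zmodule rat)) -[RHS](@mulrzl rat).
Qed.

Definition int_rat : {linear int^o -> zmodule rat} := sval (cid (linear_map int_rat_linear)).
Lemma int_ratE n : int_rat n = n%:~R :> rat.
Proof. by rewrite /int_rat; case: cid => h /= ->. Qed.

Definition QmodZ : lmodType int := Coker int_rat.
Definition QmodZ_proj : {linear zmodule rat -> QmodZ} := coker_proj int_rat.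

Lemma QmodZ_divisible : divisible QmodZ.
Proof.
move=> n d n0; have [q <-] := @coker_proj_surjective _ _ _ int_rat d.
exists (QmodZ_proj ((q : rat) / n%:R)); rewrite -[coker_proj _ _]/(QmodZ_proj q) -raddfMn.
congr (QmodZ_proj _); rewrite -[LHS](@mulr_natr rat) mulfVK //.
by rewrite pnatr_eq0 -lt0n.
Qed.

Lemma QmodZ_proj_eq0 (q : rat) : QmodZ_proj q = 0 <-> exists n : int, n%:~R = q.
Proof. by rewrite coker_proj_eq0; split=> -[n <-]; exists n; rewrite int_ratE. Qed.

(** It suffices to find a nonzero [c] killed by every integer that kills [t]: then the zero graph
    extends by [t |-> c], and divisibility extends this to all of [T]. *)
Lemma QmodZ_cogenerator (T : zmodType) (t : T) : t <> 0 ->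
  exists f : T -> QmodZ, zmod_morphism f /\ f t <> 0.
Proof.
move=> t0.
suff [c [c0 cE]] : exists c : QmodZ, c <> 0 /\ forall n : int, t *~ n = 0 -> c *~ n = 0.
  have G0p : partial_additive (fun (x : T) (d : QmodZ) => x = 0 /\ d = 0).
    by split=> // [x y d e [-> ->] [-> ->]|d []//]; rewrite !subr0.
  have [n e [/cE -> ->]//|G [Gp _ Gc]] := partial_additive_extend1 (h := t) (c := c) G0p.
  have [f [fB fE]] := additive_extension QmodZ_divisible Gp.
  by exists f; split=> //; rewrite (fE _ _ Gc).
(* If 1/m were an integer n, then m n = 1 would force m = 1. *)
have inv_ok (m : nat) : (1 < m)%N -> QmodZ_proj (m%:R^-1 : rat) <> 0.
  move=> m1 /QmodZ_proj_eq0[n nE].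
  have mn0 : m%:R != 0 :> rat by rewrite pnatr_eq0 -lt0n (ltn_trans _ m1).
  have : (m%:Z * n)%:~R = 1 :> rat by rewrite intrM nE mulfV.
  rewrite -[1]/(1%:~R) => /intr_inj /(congr1 absz); rewrite abszM /= => /eqP.
  by rewrite muln_eq1 => /andP[/eqP m_1 _]; rewrite m_1 in m1.
have [||P0|[m [m0 Pm mE]]] := @int_subgroup_principal (fun n => t *~ n = 0).
- by rewrite mulr0z.
- by move=> a b ta tb; rewrite mulrzBr ta tb subr0.
(* Here [t] has infinite order, so any nonzero class serves, such as that of 1/2; if the order is
   [m], the class of 1/m is taken. *)
- exists (QmodZ_proj (2%:R^-1 : rat)); split; first exact: inv_ok.
  by move=> n /P0 ->; rewrite mulr0z.
have m1 : (1 < m)%N.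
  by case: m m0 Pm {mE} => [|[|m]] // _; rewrite mulr1z.
exists (QmodZ_proj (m%:R^-1 : rat)); split; first exact: inv_ok.
move=> n /mE[q ->]; rewrite -raddfMz; apply/QmodZ_proj_eq0; exists q.
rewrite mulrzA; congr (_ *~ q); rewrite -[RHS](@mulrzr rat) mulVf //.
by rewrite pnatr_eq0 -lt0n.
Qed.
End QmodZ.

(* [int] acts on the left, so that [hom (regular_intR R) QmodZ] is the character
   module [Hom_Z(R, Q/Z)] with its left [R]-action *)
Definition regular_intR (R : pzRingType) : Type := zmodule R.
HB.instance Definition _ (R : pzRingType) := GRing.Lmodule.on (regular_intR R).

Section CharacterModule.
Context (R : pzRingType).
Implicit Types (r s : regular_intR R) (a b : R).
Let act r a : regular_intR R := (r : R) * a.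
Let actDl a : {morph act^~ a : r s / r + s}. Proof. by move=> r s; exact: mulrDl. Qed.
Let actDr r : {morph act r : a b / a + b}. Proof. by move=> a b; exact: mulrDr. Qed.
Let actA r a b : act r (a * b) = act (act r a) b. Proof. exact: mulrA. Qed.
Let act1 r : act r 1 = r. Proof. exact: mulr1. Qed.
Let actZl (x : int) r a : act (x *: r) a = x *: act r a.
Proof. by rewrite -[x]intz !scaler_int /act; exact: mulrzAl. Qed.
HB.instance Definition _ :=
  Lmodule_isBimodule.Build int R (regular_intR R) actDl actDr actA act1 actZl.

Definition character_module : lmodType R := hom (regular_intR R) QmodZ.

(** Coinduction is right adjoint to the forgetful functor: [f] is recovered from [h] by evaluating
    at 1. *)
Lemma character_lift (T : lmodType R) (f : T -> QmodZ) : zmod_morphism f ->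
  exists h : {linear T -> character_module},
    forall t (r : regular_intR R), h t r = f ((r : R) *: t).
Proof.
move=> fB; pose F : {additive T -> QmodZ} := HB.pack f (GRing.isZmodMorphism.Build _ _ _ fB).
have hl t : linear (fun r : regular_intR R => F ((r : R) *: t)).
  move=> a r s; rewrite scalerDl raddfD; congr (_ + _).
  rewrite -[a]intz !scaler_int -raddfMz; congr (F _); rewrite -scalerMzl //.
pose h t : character_module := sval (cid (linear_map (hl t))).
have hE t (r : regular_intR R) : h t r = F ((r : R) *: t).
  by rewrite /h /hom_fun; case: cid => k /= ->.
have [|k kE] := @linear_map R T character_module h; last by exists k => t r; rewrite kE hE.
move=> a t u; apply: hom_ext => r; rewrite [LHS]hE scalerDr raddfD scalerA.
by rewrite -[RHS]/(h t (ract r a) + h u r) !hE.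
Qed.

(** By this adjunction a retraction of [i] amounts to an additive map on [E] that equals evaluation
    at 1 on the image of [i], and divisibility of Q/Z provides it. *)
Lemma character_injective C : Ext1_eq0 C character_module.
Proof.
apply: split_ext => E i p se; have [ii ip ps] := se.
pose G (x : E) (d : QmodZ) := exists u, x = i u /\ d = u (1 : regular_intR R).
have Gp : partial_additive G.
  split.
  - by exists 0; rewrite linear0.
  - move=> _ _ _ _ [u [-> ->]] [v [-> ->]]; exists (u - v); rewrite linearB; split=> //.
  - by move=> d [u [/esym u0 ->]]; rewrite (ii u 0) // u0 linear0.
have [f [fB fE]] := additive_extension QmodZ_divisible Gp.
have [h hE] := character_lift fB.
apply: (section_of_retraction (r := h) se) => u; apply: hom_ext => r.
rewrite [LHS]hE -linearZ (fE _ _ (ex_intro _ _ (conj erefl erefl))).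
rewrite [LHS]hom_scaleE; congr (u _); exact: mul1r.
Qed.

Lemma character_cogenerator (T : lmodType R) (t : T) :
  t <> 0 -> exists h : {linear T -> character_module}, h t <> 0.
Proof.
move=> /QmodZ_cogenerator[f [fB ft]]; have [h hE] := character_lift fB.
by exists h => ht; apply: ft; rewrite -[t]scale1r -(hE t (1 : R)) ht.
Qed.
End CharacterModule.

(** * Exactness of tensor and Hom functors *)

Section TensorExact.
Context (A B : pzRingType) (M : bimodType B A).
Implicit Types X Y Z W E : lmodType A.

Lemma linear_tensor_ext X (Z : lmodType B) (h k : {linear tensor M X -> Z}) :
  (forall m x, h (tens m x) = k (tens m x)) -> h =1 k.
Proof. by apply: tensor_ext => t u; rewrite linearB. Qed.

Lemma tensor_map_comp X Y Z (h : {linear X -> Y}) (k : {linear Y -> Z}) t :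
  tensor_map M k (tensor_map M h t) = tensor_map M (k \o h : {linear X -> Z}) t.
Proof.
apply: (linear_tensor_ext (h := tensor_map M k \o tensor_map M h : {linear _ -> _})).
by move=> m x; rewrite /= !tensor_mapE.
Qed.

Lemma tensor_map_eq X Y (h k : {linear X -> Y}) : h =1 k -> tensor_map M h =1 tensor_map M k.
Proof. by move=> hk; apply: linear_tensor_ext => m x; rewrite /= !tensor_mapE hk. Qed.

Lemma tensor_map_id X t : tensor_map M (idfun : {linear X -> X}) t = t.
Proof.
apply: (linear_tensor_ext (k := idfun : {linear tensor M X -> tensor M X})).
by move=> m x; rewrite /= tensor_mapE.
Qed.

Lemma tensor_map0 X Y (h : {linear X -> Y}) t : (forall x, h x = 0) -> tensor_map M h t = 0.
Proof.
move=> h0; elim/tensor_ind: t => [|m x t IH]; first by rewrite linear0.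
by rewrite linearD /= tensor_mapE h0 tens0r IH addr0.
Qed.

Lemma tensor_map_surjective X Y (h : {linear X -> Y}) :
  surjective h -> surjective (tensor_map M h).
Proof.
move=> hs; elim/tensor_ind => [|m y t [u <-]]; first by exists 0; rewrite linear0.
by have [x <-] := hs y; exists (tens m x + u); rewrite linearD /= tensor_mapE.
Qed.

(** For a set-theoretic section [s] of [k], the class of [tens m (s z)] modulo the image of M (x) h
    does not depend on [s]. The resulting map [l] on M (x) Z composed with M (x) k is the cokernel
    projection, so the kernel of M (x) k lies in that image. *)
Lemma tensor_right_exact X Y Z (h : {linear X -> Y}) (k : {linear Y -> Z}) :
  exact_at h k -> surjective k -> exact_at (tensor_map M h) (tensor_map M k).
Proof.
move=> hk ks t; split; last first.
  by move=> [u <-]; rewrite /= tensor_map_comp tensor_map0 // => x; apply/hk; exists x.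
pose pr : {linear tensor M Y -> Coker (tensor_map M h)} := coker_proj (tensor_map M h).
pose s z := sval (cid (ks z)); have sK z : k (s z) = z by rewrite /s; case: cid.
have prE m y y' : k y = k y' -> pr (tens m y) = pr (tens m y').
  move=> e; apply/coker_proj_eq; have /hk[x xE] : k (y - y') = 0 by rewrite linearB e subrr.
  exists (tens m x); rewrite /= tensor_mapE xE; apply/eqP.
  by rewrite eq_sym subr_eq -tensDr subrK.
have [||l lE] := @tensor_linear A B M Z _ (fun m z => pr (tens m (s z))).
- split=> [m m' z|m z z'|m a z]; first by rewrite tensDl linearD.
    by rewrite -linearD -tensDr; apply: prE; rewrite linearD !sK.
  by rewrite tens_ract; apply: prE; rewrite linearZ !sK.
- by move=> b m z; rewrite -linearZ /= tensZ.
move=> kt; apply/coker_proj_eq0; rewrite -/(pr t) -[RHS](linear0 l) -kt.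
apply: (linear_tensor_ext (k := l \o tensor_map M k : {linear _ -> _})) => m y.
by rewrite /= tensor_mapE lE; apply: prE; rewrite sK.
Qed.

(** As in [ext_extend], P1 -> P0 x X -> E -> 0 is exact, with first map [(d, - v)]. If M (x) i kills
    [t], then (0, t) is the image of some [w]. Its first component says that [w] is a cycle, so by
    Tor it comes from P2; there [v] vanishes, and the second component gives t = 0. *)
Lemma tor_injective X E W (i : {linear X -> E}) (p : {linear E -> W}) :
  Tor1_eq0 M W -> short_exact i p -> injective (tensor_map M i).
Proof.
move=> tor [ii ip ps]; have [P] := projective_resolution_exists W.
have [u uE] := @res_projective _ _ P 0 _ _ p (res_aug P) ps.
have d0 x : res_aug P (res_diff P 0 x) = 0 by apply/(@res_exact0 _ _ P); exists x.
have d1 x : res_diff P 0 (res_diff P 1 x) = 0 by apply/(@res_exactS _ _ P 0); exists x.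
have [|v vE] := @factor_through_mono _ _ _ _ i (u \o res_diff P 0 : {linear _ -> _}) ii.
  by move=> x; apply/ip; rewrite /= uE d0.
pose S := (res_obj P 0 * X)%type.
have [d dE] := @linear_map A (res_obj P 1) S (fun z => (res_diff P 0 z, - v z))
  ltac:(by move=> a x y; rewrite /= !linearP).
have [s sE] := @linear_map A S E (fun z => u z.1 + i z.2)
  ltac:(by move=> a x y; rewrite /= !linearP /= scalerDr addrACA).
have [r rE] := @linear_map A X S (fun x => (0, x))
  ltac:(by move=> a x y; congr pair; rewrite /= scaler0 addr0).
have ds : exact_at d s.
  move=> [x y]; rewrite sE /=; split=> [e|[z]]; last first.
    by rewrite dE => -[<- <-]; rewrite linearN vE /= subrr.
  have px0 : p (i y) = 0 by apply/ip; exists y.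
  have /(@res_exact0 _ _ P)[z zx] : res_aug P x = 0.
    by move: (congr1 p e); rewrite linearD linear0 px0 addr0 uE.
  exists z; rewrite dE zx; congr pair; apply: ii.
  by rewrite linearN vE /= zx; apply/esym/eqP; rewrite -addr_eq0 addrC e.
have ss : surjective s.
  move=> e; have [x xE] := @res_aug_surjective _ _ P (p e).
  have /ip[a aE] : p (e - u x) = 0 by rewrite linearB uE xE subrr.
  by exists (x, a); rewrite sE /= aE addrC subrK.
apply: linear_inj => t it.
have /(tensor_right_exact ds ss)[w wE] : tensor_map M s (tensor_map M r t) = 0.
  rewrite /= tensor_map_comp -[RHS]it; apply: tensor_map_eq => x /=.
  by rewrite sE rE /= linear0 add0r.
have : tensor_map M (res_diff P 0) w = 0.
  have := congr1 (tensor_map M (fst : {linear S -> res_obj P 0})) wE.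
  rewrite /= !tensor_map_comp [RHS]tensor_map0 => [<-|x /=]; last by rewrite rE.
  by apply: tensor_map_eq => x /=; rewrite dE.
move=> /(tor P)[z zw].
have := congr1 (tensor_map M (snd : {linear S -> X})) wE; rewrite /= !tensor_map_comp.
rewrite (tensor_map_eq (k := (idfun : {linear X -> X}))) ?tensor_map_id => [|x /=]; last first.
  by rewrite rE.
move=> <-; rewrite -zw /= tensor_map_comp tensor_map0 // => x /=.
by rewrite dE /=; apply: ii; rewrite linearN vE /= d1 !linear0.
Qed.
End TensorExact.

Section HomMap.
Context (A B : pzRingType) (N : bimodType A B).
Implicit Types (X Y Z : lmodType A) (W : lmodType B).

Definition hom_comp X Y (h : {linear X -> Y}) (u : hom N X) : hom N Y :=
  (h \o (u : {linear N -> X}) : {linear N -> Y}).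

Lemma hom_compE X Y (h : {linear X -> Y}) u n : hom_comp h u n = h (u n).
Proof. by []. Qed.

Lemma hom_comp_linear X Y (h : {linear X -> Y}) : linear (hom_comp h).
Proof.
move=> b u v; apply: hom_ext => n.
rewrite hom_compE -[LHS]/(h (u (ract n b) + v n)) linearD //.
Qed.
HB.instance Definition _ X Y (h : {linear X -> Y}) :=
  GRing.isLinear.Build B (hom N X) (hom N Y) *:%R (hom_comp h) (hom_comp_linear h).

Lemma hom_short_exact X Y Z (i : {linear X -> Y}) (p : {linear Y -> Z}) :
  Ext1_eq0 N X -> short_exact i p ->
  short_exact (hom_comp i : {linear hom N X -> hom N Y}) (hom_comp p).
Proof.
move=> ext se; have [ii ip ps] := se; split=> [u v e|u|w].
- by apply: hom_ext => n; apply: ii; rewrite -!hom_compE e.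
- split=> [pu|[v <-]]; last first.
    by apply: hom_ext => n; rewrite !hom_compE (short_exact_comp0 _ se).
  have [|v vE] := @factor_through_mono _ _ _ _ i (u : {linear N -> Y}) ii.
    by move=> n; apply/ip; rewrite -[p _]/(hom_comp p u n) pu.
  by exists (v : hom N X); apply: hom_ext => n; rewrite hom_compE [LHS]vE.
have [k kE] := ext_lift (w : {linear N -> Z}) ext se.
by exists (k : hom N Y); apply: hom_ext => n; rewrite hom_compE [LHS]kE.
Qed.

(** The inverse of [adjoint] in the tensor-Hom adjunction: it recovers g from g~. *)
Lemma tensor_adjunction X W (k : {linear W -> hom N X}) :
  exists g : {linear tensor N W -> X}, forall n w, g (tens n w) = hom_fun (k w) n.
Proof.
apply: tensor_linear => [|a n w]; last by rewrite /hom_fun linearZ.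
split=> [n n' w|n w w'|n b w]; first by rewrite /hom_fun linearD.
  by rewrite linearD.
by rewrite linearZ.
Qed.
Definition tensor_adj X W (k : {linear W -> hom N X}) : {linear tensor N W -> X} :=
  sval (cid (tensor_adjunction k)).
Lemma tensor_adjE X W (k : {linear W -> hom N X}) n w : tensor_adj k (tens n w) = hom_fun (k w) n.
Proof. by rewrite /tensor_adj; case: cid. Qed.
End HomMap.

(** * Modules over the corner of a ring *)

Section Corner.
Context (R C : pzRingType) (L : lmodType R) (j : C -> R).
Hypotheses (jB : zmod_morphism j) (jM : forall a b, j (a * b) = j a * j b).

(** [j] is multiplicative but need not be unital, so [j 1] is an idempotent e. Its fixed vectors
    form eL, on which [C] acts unitally through [j]. *)
Definition corner_pred : {pred L} := [pred l | j 1 *: l == l].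
Lemma corner_zmod_closed : zmod_closed corner_pred.
Proof.
split=> [|u v]; rewrite !inE ?scaler0 //.
by move=> /eqP hu /eqP hv; rewrite scalerBr hu hv.
Qed.
HB.instance Definition _ := GRing.isZmodClosed.Build L corner_pred corner_zmod_closed.

Definition corner : Type := {l : L | corner_pred l}.
HB.instance Definition _ := SubChoice.on corner.
HB.instance Definition _ := [SubChoice_isSubZmodule of corner by <:].

Lemma corner_scale_subproof (a : C) (l : L) : corner_pred (j a *: l).
Proof. by apply/eqP; rewrite scalerA -jM mul1r. Qed.
Definition corner_in a l : corner := exist _ (j a *: l) (corner_scale_subproof a l).
Definition corner_scale (a : C) (l : corner) : corner := corner_in a (val l).

Lemma corner_scaleA a b l : corner_scale a (corner_scale b l) = corner_scale (a * b) l.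
Proof. by apply: val_inj; rewrite /= scalerA jM. Qed.
Lemma corner_scale1 : left_id 1 corner_scale.
Proof. by move=> l; apply: val_inj; apply/eqP; exact: (valP l). Qed.
Lemma corner_scaleDr : right_distributive corner_scale +%R.
Proof. by move=> a l l'; apply: val_inj; rewrite /= scalerDr. Qed.
Lemma corner_scaleDl l : {morph corner_scale^~ l : a b / a + b}.
Proof.
move=> a b; apply: val_inj; rewrite /= -scalerDl; congr (_ *: _).
pose J : {additive C -> R} := HB.pack j (GRing.isZmodMorphism.Build _ _ j jB).
exact: (raddfD J).
Qed.
Definition corner_lmod : lmodType C := HB.pack corner
  (GRing.Zmodule_isLmodule.Build C corner corner_scaleA corner_scale1 corner_scaleDr corner_scaleDl).
End Corner.

(** * Quadruples *)

Section Quadruples.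
Context (A B : pzRingType) (c : morita_context A B).
Local Notation M := (mctx_M c).
Local Notation N := (mctx_N c).
Local Notation phi := (mctx_phi c).
Local Notation psi := (mctx_psi c).
Local Notation Lam := (morita_ring c).
Implicit Types q e : quadruple c.
Implicit Types W : lmodType A.

(** The map through which the equation on g f is expressed: it becomes g~ f = [psi_hom], see
    [adjoint_psi]. *)
Lemma psi_hom_exists W : exists h : {linear tensor M W -> hom N W},
  forall m w n, hom_fun (h (tens m w)) n = psi (tens n m) *: w.
Proof.
have bl (m : M) (w : W) : linear (fun n : N => psi (tens n m) *: w).
  move=> a n n'; rewrite tensDl -tensZ raddfD /= mctx_psiZ scalerDl scalerA //.
pose beta (m : M) (w : W) : hom N W := sval (cid (linear_map (bl m w))).
have bE m w n : hom_fun (beta m w) n = psi (tens n m) *: w.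
  by rewrite /beta /hom_fun; case: cid => h /= ->.
have [||h hE] := @tensor_linear A B M W (hom N W) beta.
- split=> [m m' w|m w w'|m a w]; apply: hom_ext => n.
  + by rewrite -[RHS]/(hom_fun (beta m w) n + hom_fun (beta m' w) n) !bE tensDr raddfD scalerDl.
  + by rewrite -[RHS]/(hom_fun (beta m w) n + hom_fun (beta m w') n) !bE scalerDr.
  by rewrite !bE scalerA -mctx_psi_ract ract_tens.
- move=> b m w; apply: hom_ext => n.
  by rewrite [RHS]hom_scaleE [LHS]bE [RHS]bE -tens_ract.
by exists h => m w n; rewrite hE [LHS]bE.
Qed.
Definition psi_hom W : {linear tensor M W -> hom N W} := sval (cid (psi_hom_exists W)).
Lemma psi_homE W m w n : hom_fun (psi_hom W (tens m w)) n = psi (tens n m) *: w.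
Proof. by rewrite /psi_hom; case: cid. Qed.

Lemma psi_hom_natural W W' (h : {linear W -> W'}) t :
  psi_hom W' (tensor_map M h t) = hom_comp h (psi_hom W t).
Proof.
apply: (linear_tensor_ext (h := psi_hom W' \o tensor_map M h : {linear _ -> _})
  (k := hom_comp h \o psi_hom W : {linear _ -> _})) => m w /=.
by apply: hom_ext => n; rewrite tensor_mapE hom_compE !psi_homE linearZ.
Qed.

Lemma adjoint_psi q t : adjoint (quad_g q) (quad_f q t) = psi_hom (quad_X q) t.
Proof.
apply: (linear_tensor_ext (h := adjoint (quad_g q) \o quad_f q : {linear _ -> _})) => m x /=.
by apply: hom_ext => n; rewrite adjointE quad_gf psi_homE.
Qed.

(* the compatibility with [g] is stated through its adjoint *)
Definition quad_hom q e (a : {linear quad_X q -> quad_X e}) (b : {linear quad_Y q -> quad_Y e}) :=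
  (forall t, b (quad_f q t) = quad_f e (tensor_map M a t)) /\
  (forall y, hom_comp a (adjoint (quad_g q) y) = adjoint (quad_g e) (b y)).

Lemma quad_hom_linear q e a b : @quad_hom q e a b ->
  exists h : {linear quad_module q -> quad_module e}, forall z, h z = (a z.1, b z.2).
Proof.
move=> [hf hg]; pose h (z : quad_module q) : quad_module e := (a z.1, b z.2).
have [|k kE] := @linear_map Lam (quad_module q) (quad_module e) h; last by exists k.
move=> r [x y] [x' y']; rewrite /h; congr pair => /=.
  rewrite !linearD /= linearZ; congr (_ + _ + _).
  by have := congr1 (fun u : hom N _ => u (ur r)) (hg y).
by rewrite !linearD /= linearZ hf /= tensor_mapE.
Qed.

Definition corner_A (a : A) : Lam := MoritaRing a 0 0 0.
Definition corner_B (b : B) : Lam := MoritaRing 0 0 0 b.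
Definition corner_M (m : M) : Lam := MoritaRing 0 0 m 0.
Definition corner_N (n : N) : Lam := MoritaRing 0 n 0 0.

Lemma quad_scaleE q (r : Lam) (z : quad_module q) :
  r *: z = (ul r *: z.1 + quad_g q (tens (ur r) z.2),
            quad_f q (tens (dl r) z.1) + dr r *: z.2).
Proof. by []. Qed.

(** Commuting with the two diagonal idempotents makes [h] diagonal; commuting with the entries from
    M and N gives compatibility with f and g. *)
Lemma linear_quad_hom q e (h : {linear quad_module q -> quad_module e}) :
  exists a b, @quad_hom q e a b /\ forall z, h z = (a z.1, b z.2).
Proof.
pose inl x : quad_module q := (x, 0); pose inr y : quad_module q := (0, y).
have inlZ a x : inl (a *: x) = corner_A a *: inl x.
  by rewrite quad_scaleE /= !tens0l !linear0 scaler0 !addr0.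
have inrZ b y : inr (b *: y) = corner_B b *: inr y.
  by rewrite quad_scaleE /= !tens0l !linear0 scaler0 !add0r.
have inlD x x' : inl (x + x') = inl x + inl x' by congr pair; rewrite /= addr0.
have inrD y y' : inr (y + y') = inr y + inr y' by congr pair; rewrite /= addr0.
have h2 x : (h (inl x)).2 = 0.
  rewrite -[x]scale1r inlZ linearZ /= tens0l linear0 scale0r addr0 //.
have h1 y : (h (inr y)).1 = 0.
  by rewrite -[y]scale1r inrZ linearZ /= tens0l linear0 scale0r addr0.
have [a aE] := @linear_map A (quad_X q) (quad_X e) (fun x => (h (inl x)).1)
  ltac:(by move=> a x x'; rewrite inlD linearD inlZ linearZ /= tens0l linear0 addr0).
have [b bE] := @linear_map B (quad_Y q) (quad_Y e) (fun y => (h (inr y)).2)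
  ltac:(by move=> b y y'; rewrite inrD linearD inrZ linearZ /= tens0l linear0 add0r).
have hl x : h (inl x) = (a x, 0) by rewrite [LHS]surjective_pairing aE h2.
have hr y : h (inr y) = (0, b y) by rewrite [LHS]surjective_pairing bE h1.
exists a, b; split; last first.
  move=> [x y]; have -> : (x, y) = inl x + inr y by congr pair; rewrite /= ?addr0 ?add0r.
  by rewrite linearD hl hr; congr pair; rewrite /= ?addr0 ?add0r.
split=> [t|y].
  apply: (linear_tensor_ext (h := b \o quad_f q : {linear _ -> _})
    (k := quad_f e \o tensor_map M a : {linear _ -> _})) => m x /=; rewrite tensor_mapE.
  have : h (corner_M m *: inl x) = corner_M m *: h (inl x) by rewrite linearZ.
  rewrite !quad_scaleE hl /= !tens0l !linear0 !scale0r !addr0.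
  by rewrite hr => -[].
apply: hom_ext => n; rewrite hom_compE !adjointE.
have : h (corner_N n *: inr y) = corner_N n *: h (inr y) by rewrite linearZ.
rewrite !quad_scaleE hr /= !tens0l !linear0 !scale0r !add0r ?addr0.
by rewrite hl => -[].
Qed.

(** Peirce decomposition: [L] is the sum of its corners at the two diagonal idempotents, and f, g
    are the actions of the entries from M and N between them. *)
Lemma quad_of (L : lmodType Lam) : exists q, isomorphic L (quad_module q).
Proof.
have jAB : zmod_morphism corner_A by move=> a a'; congr MoritaRing; rewrite /= subr0.
have jBB : zmod_morphism corner_B by move=> b b'; congr MoritaRing; rewrite /= subr0.
have jAM a a' : corner_A (a * a') = corner_A a * corner_A a'.
  by congr MoritaRing; rewrite /= ?tens0l ?raddf0 ?scaler0 ?ract0l ?mulr0 ?addr0 ?scale0r.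
have jBM b b' : corner_B (b * b') = corner_B b * corner_B b'.
  by congr MoritaRing; rewrite /= ?tens0l ?raddf0 ?scaler0 ?ract0l ?mulr0 ?add0r ?scale0r.
pose X := corner_lmod L jAB jAM; pose Y := corner_lmod L jBB jBM.
have vX (x : X) : corner_A 1 *: (val x : L) = val x by apply/eqP; exact: (valP x).
have vY (y : Y) : corner_B 1 *: (val y : L) = val y by apply/eqP; exact: (valP y).
pose inX (l : L) : X := corner_in jAM 1 l; pose inY (l : L) : Y := corner_in jBM 1 l.
have inXE (l : L) : val (inX l) = corner_A 1 *: l by [].
have inYE (l : L) : val (inY l) = corner_B 1 *: l by [].
have XZ a (x : X) : val (a *: x) = corner_A a *: (val x : L) by [].
have YZ b (y : Y) : val (b *: y) = corner_B b *: (val y : L) by [].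
have simp := (tens0l, tens0r, raddf0, scaler0, scale0r, ract0l, ract0r, mulr0, mul0r, addr0, add0r).
have BM b m : corner_B b * corner_M m = corner_M (b *: m).
  by congr MoritaRing; rewrite /= ?simp.
have AN a n : corner_A a * corner_N n = corner_N (a *: n).
  by congr MoritaRing; rewrite /= ?simp.
have MA m a : corner_M m * corner_A a = corner_M (ract m a).
  by congr MoritaRing; rewrite /= ?simp.
have NB n b : corner_N n * corner_B b = corner_N (ract n b).
  by congr MoritaRing; rewrite /= ?simp.
have MN m n : corner_M m * corner_N n = corner_B (phi (tens m n)).
  by congr MoritaRing; rewrite /= ?simp.
have NM n m : corner_N n * corner_M m = corner_A (psi (tens n m)).
  by congr MoritaRing; rewrite /= ?simp.
have MD m m' : corner_M (m + m') = corner_M m + corner_M m'.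
  by congr MoritaRing; rewrite /= ?simp.
have ND n n' : corner_N (n + n') = corner_N n + corner_N n'.
  by congr MoritaRing; rewrite /= ?simp.
have [||f fE] := @tensor_linear A B M X Y (fun m x => inY (corner_M m *: (val x : L))).
- split=> [m m' x|m x x'|m a x]; apply: val_inj.
  + by rewrite [RHS]/= !inYE MD scalerDl scalerDr.
  + by rewrite [RHS]/= !inYE scalerDr scalerDr.
  by rewrite !inYE XZ -MA -scalerA.
- by move=> b m x; apply: val_inj; rewrite YZ !inYE !scalerA -mulrA !BM !scale1r.
have [||g gE] := @tensor_linear B A N Y X (fun n y => inX (corner_N n *: (val y : L))).
- split=> [m m' x|m x x'|m a x]; apply: val_inj.
  + by rewrite [RHS]/= !inXE ND scalerDl scalerDr.
  + by rewrite [RHS]/= !inXE scalerDr scalerDr.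
  by rewrite !inXE YZ -NB -scalerA.
- by move=> b m x; apply: val_inj; rewrite XZ !inXE !scalerA -mulrA !AN !scale1r.
have gf n m x : g (tens n (f (tens m x))) = psi (tens n m) *: x.
  by apply: val_inj; rewrite fE gE inXE XZ inYE !scalerA AN scale1r NB ract1 NM.
have fg m n y : f (tens m (g (tens n y))) = phi (tens m n) *: y.
  by apply: val_inj; rewrite gE fE inYE YZ inXE !scalerA BM scale1r MA ract1 MN.
pose q := Quadruple gf fg; exists q.
pose h (l : L) : quad_module q := (inX l, inY l).
have [|k kE] := @linear_map Lam L (quad_module q) h.
  move=> r l l'; congr pair; apply: val_inj.
    rewrite -[RHS]/(corner_A (ul r) *: val (inX l) + val (g (tens (ur r) (inY l))) + val (inX l')).
    rewrite gE !inXE !inYE scalerDr; congr (_ + _).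
    rewrite !scalerA -scalerDl; congr (_ *: _).
    by case: r => a n m b; congr MoritaRing; rewrite /= ?simp ?scale1r ?ract1 ?mul1r ?mulr1.
  rewrite -[RHS]/(val (f (tens (dl r) (inX l))) + corner_B (dr r) *: val (inY l) + val (inY l')).
  rewrite fE !inYE !inXE scalerDr; congr (_ + _).
  rewrite !scalerA -scalerDl; congr (_ *: _).
  by case: r => a n m b; congr MoritaRing; rewrite /= ?simp ?scale1r ?ract1 ?mul1r ?mulr1.
exists k; apply: inj_surj_bij.
  apply: linear_inj => l; rewrite kE /h => -[eX eY].
  have lX : corner_A 1 *: l = 0 by exact: eX.
  have lY : corner_B 1 *: l = 0 by exact: eY.
  rewrite -[l]scale1r; have -> : 1 = corner_A 1 + corner_B 1 :> Lam.
    by congr MoritaRing; rewrite /= ?addr0 ?add0r.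
  by rewrite scalerDl lX lY addr0.
move=> [x y]; exists (val x + val y); rewrite kE /h; congr pair; apply: val_inj.
  rewrite inXE scalerDr vX -(vY y) scalerA.
  suff -> : corner_A 1 * corner_B 1 = 0 by rewrite scale0r addr0.
  by congr MoritaRing; rewrite /= ?simp.
rewrite inYE scalerDr vY -(vX x) scalerA.
suff -> : corner_B 1 * corner_A 1 = 0 by rewrite scale0r add0r.
by congr MoritaRing; rewrite /= ?simp.
Qed.
End Quadruples.

(** * Short exact sequences and Ext in terms of quadruples *)

Section QuadExact.
Context (A B : pzRingType) (c : morita_context A B).
Local Notation M := (mctx_M c).
Local Notation N := (mctx_N c).
Implicit Types q e : quadruple c.

Definition quad_short_exact q1 q2 q3
    (a : {linear quad_X q1 -> quad_X q2}) (b : {linear quad_Y q1 -> quad_Y q2})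
    (a' : {linear quad_X q2 -> quad_X q3}) (b' : {linear quad_Y q2 -> quad_Y q3}) :=
  [/\ @quad_hom A B c q1 q2 a b, @quad_hom A B c q2 q3 a' b', short_exact a a' & short_exact b b'].

Lemma quad_short_exact_linear q1 q2 q3 a b a' b' :
    @quad_short_exact q1 q2 q3 a b a' b' ->
  exists (h : {linear quad_module q1 -> quad_module q2})
         (k : {linear quad_module q2 -> quad_module q3}),
    [/\ short_exact h k, forall z, h z = (a z.1, b z.2) & forall z, k z = (a' z.1, b' z.2)].
Proof.
move=> [/quad_hom_linear[h hE] /quad_hom_linear[k kE] [ai aa as'] [bi bb bs]].
exists h, k; split=> //; split.
- by move=> [x y] [x' y']; rewrite !hE /= => -[/ai -> /bi ->].
- move=> [x y]; rewrite kE; split=> [[/aa[x' /= <-] /bb[y' /= <-]]|[[x' y']]].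
    by exists (x', y'); rewrite hE.
  by rewrite hE => -[<- <-] /=; congr pair; [apply/aa; exists x'|apply/bb; exists y'].
by move=> [x y]; have [x' <-] := as' x; have [y' <-] := bs y; exists (x', y'); rewrite kE.
Qed.

Lemma linear_quad_short_exact q1 q2 q3
    (h : {linear quad_module q1 -> quad_module q2})
    (k : {linear quad_module q2 -> quad_module q3}) : short_exact h k ->
  exists a b a' b', [/\ @quad_short_exact q1 q2 q3 a b a' b',
    forall z, h z = (a z.1, b z.2) & forall z, k z = (a' z.1, b' z.2)].
Proof.
move=> [hi hk ks]; have [a [b [ab hE]]] := linear_quad_hom h.
have [a' [b' [ab' kE]]] := linear_quad_hom k.
exists a, b, a', b'; split=> //; split=> //; split.
- move=> x x' e; have /hi[] // : h (x, 0) = h (x', 0) by rewrite !hE /= e.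
- move=> x; split=> [x0|[x' <-]].
    have /hk[[x' y'] e] : k (x, 0) = 0 by rewrite kE /= x0 linear0.
    by exists x'; move: e; rewrite hE => -[].
  have /hk : exists u, h u = (a x', 0) by exists (x', 0); rewrite hE /= linear0.
  by rewrite kE => -[].
- by move=> x; have [[x' y'] e] := ks (x, 0); exists x'; move: e; rewrite kE => -[].
- move=> x x' e; have /hi[] // : h (0, x) = h (0, x') by rewrite !hE /= e.
- move=> x; split=> [x0|[x' <-]].
    have /hk[[x' y'] e] : k (0, x) = 0 by rewrite kE /= x0 linear0.
    by exists y'; move: e; rewrite hE => -[].
  have /hk : exists u, h u = (0, b x') by exists (0, x'); rewrite hE /= linear0.
  by rewrite kE => -[].
- by move=> x; have [[x' y'] e] := ks (0, x); exists y'; move: e; rewrite kE => -[].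
Qed.

(** The middle term of an arbitrary extension may be taken to be a quadruple, so that splittings can
    be sought componentwise. *)
Lemma quad_short_exact_middle (q q' : quadruple c) (E : lmodType (morita_ring c))
    (i : {linear quad_module q' -> E}) (p : {linear E -> quad_module q}) : short_exact i p ->
  exists e (h : {linear E -> quad_module e}) (k : {linear quad_module e -> E}),
    [/\ cancel h k, cancel k h & exists a b a' b',
      [/\ @quad_short_exact q' e q a b a' b', forall z, h (i z) = (a z.1, b z.2)
        & forall z, p (k z) = (a' z.1, b' z.2)]].
Proof.
move=> se; have [e eE] := quad_of E; have [k kb] := isomorphic_sym eE.
have [h hK kK] := kb; have [|h' h'E] := @linear_map _ _ _ h.
  by move=> r x y; rewrite -{1}[x]kK -{1}[y]kK -linearP hK.
have hb : bijective h' by exists k => x; rewrite h'E ?kK ?hK.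
exists e, h', k; split; [by move=> x; rewrite h'E kK|by move=> x; rewrite h'E hK|].
have [ii ip ps] := se.
have se' : short_exact (h' \o i : {linear _ -> _}) (p \o k : {linear _ -> _}).
  split=> [x y|x|x] /=.
  - by move/(bij_inj hb)/ii.
  - rewrite ip; split=> -[y yE]; exists y; first by rewrite yE h'E hK.
    by apply: (bij_inj hb); rewrite yE h'E hK.
  - by have [y <-] := ps x; exists (h y); rewrite kK.
have [a [b [a' [b' [ab iE pE]]]]] := linear_quad_short_exact se'.
by exists a, b, a', b'.
Qed.

Lemma quad_ext_sections q q' :
    (forall e a b a' b', @quad_short_exact q' e q a b a' b' ->
      exists s t, [/\ @quad_hom A B c q e s t, forall x, a' (s x) = x & forall y, b' (t y) = y]) ->
  Ext1_eq0 (quad_module q) (quad_module q').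
Proof.
move=> spl; apply: split_ext => E i p /quad_short_exact_middle.
move=> [e [h [k [hK kK [a [b [a' [b' [se hi pk]]]]]]]]].
have [s [t [st sE tE]]] := spl _ _ _ _ _ se; have [u uE] := quad_hom_linear st.
exists (k \o u : {linear quad_module q -> E}) => -[x y] /=.
by rewrite pk uE /= sE tE.
Qed.

Lemma quad_ext_retractions q q' :
    (forall e a b a' b', @quad_short_exact q' e q a b a' b' ->
      exists s t, [/\ @quad_hom A B c e q' s t, forall x, s (a x) = x & forall y, t (b y) = y]) ->
  Ext1_eq0 (quad_module q) (quad_module q').
Proof.
move=> spl; apply: split_ext => E i p sip; have := quad_short_exact_middle sip.
move=> [e [h [k [hK kK [a [b [a' [b' [se hi pk]]]]]]]]].
have [s [t [st sE tE]]] := spl _ _ _ _ _ se; have [u uE] := quad_hom_linear st.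
apply: (section_of_retraction (r := u \o h : {linear E -> quad_module q'}) sip) => -[x y] /=.
by rewrite hi uE /= sE tE.
Qed.

Lemma quad_ext_extend q1 q2 q3 q' a b a' b' u v :
    Ext1_eq0 (quad_module q3) (quad_module q') ->
    @quad_short_exact q1 q2 q3 a b a' b' -> @quad_hom A B c q1 q' u v ->
  exists u' v', [/\ @quad_hom A B c q2 q' u' v', forall x, u' (a x) = u x & forall y, v' (b y) = v y].
Proof.
move=> ext /quad_short_exact_linear[h [k [se hE kE]]] /quad_hom_linear[w wE].
have [w' w'E] := ext_extend w ext se; have [u' [v' [uv' uvE]]] := linear_quad_hom w'.
exists u', v'; split=> // [x|y].
  by have := w'E (x, 0); rewrite hE wE uvE => -[].
by have := w'E (0, y); rewrite hE wE uvE => -[].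
Qed.

Lemma quad_ext_lift q1 q2 q3 q' a b a' b' u v :
    Ext1_eq0 (quad_module q') (quad_module q1) ->
    @quad_short_exact q1 q2 q3 a b a' b' -> @quad_hom A B c q' q3 u v ->
  exists u' v', [/\ @quad_hom A B c q' q2 u' v', forall x, a' (u' x) = u x & forall y, b' (v' y) = v y].
Proof.
move=> ext /quad_short_exact_linear[h [k [se hE kE]]] /quad_hom_linear[w wE].
have [w' w'E] := ext_lift w ext se; have [u' [v' [uv' uvE]]] := linear_quad_hom w'.
exists u', v'; split=> // [x|y].
  by have := w'E (x, 0); rewrite wE uvE kE => -[].
by have := w'E (0, y); rewrite wE uvE kE => -[].
Qed.

Lemma quad_ext_extl q1 q2 q3 a b a' b' q : @quad_short_exact q1 q2 q3 a b a' b' ->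
    Ext1_eq0 (quad_module q1) (quad_module q) -> Ext1_eq0 (quad_module q3) (quad_module q) ->
  Ext1_eq0 (quad_module q2) (quad_module q).
Proof. by move=> /quad_short_exact_linear[h [k [se _ _]]]; exact: ext_extl se. Qed.

Lemma quad_ext_extr q1 q2 q3 a b a' b' q : @quad_short_exact q1 q2 q3 a b a' b' ->
    Ext1_eq0 (quad_module q) (quad_module q1) -> Ext1_eq0 (quad_module q) (quad_module q3) ->
  Ext1_eq0 (quad_module q) (quad_module q2).
Proof. by move=> /quad_short_exact_linear[h [k [se _ _]]]; exact: ext_extr se. Qed.
End QuadExact.

(** * The functors T, H and Z *)

Definition zero_map (R : pzRingType) (U V : lmodType R) : {linear U -> V} := \0 : U -> V.
Arguments zero_map {R} U V.

Section Functors.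
Context (A B : pzRingType) (c : morita_context A B).
Local Notation M := (mctx_M c).
Local Notation N := (mctx_N c).
Local Notation phi := (mctx_phi c).
Local Notation psi := (mctx_psi c).
Hypothesis MN0 : forall t : tensor M N, t = 0.
Implicit Types (q e : quadruple c) (W X : lmodType A) (V Y : lmodType B).

Lemma quad_mk_gf X Y (f : {linear tensor M X -> Y}) (k : {linear Y -> hom N X}) :
  (forall t, k (f t) = psi_hom c X t) -> forall n m x,
  tensor_adj k (tens n (f (tens m x))) = psi (tens n m) *: x.
Proof. by move=> kf n m x; rewrite tensor_adjE kf psi_homE. Qed.

(** The left side is the image of [tens m n] under M (x) k(y) followed by [f], the right side its
    image under phi acting on [y]; both vanish with M (x) N. *)
Lemma quad_mk_fg X Y (f : {linear tensor M X -> Y}) (k : {linear Y -> hom N X}) m n y :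
  f (tens m (tensor_adj k (tens n y))) = phi (tens m n) *: y.
Proof.
rewrite tensor_adjE [tens m n]MN0 raddf0 scale0r.
have -> : tens m (hom_fun (k y) n) = tensor_map M (k y : {linear N -> X}) (tens m n).
  by rewrite tensor_mapE.
by rewrite [tens m n]MN0 raddf0 linear0.
Qed.

Definition quad_mk X Y (f : {linear tensor M X -> Y}) (k : {linear Y -> hom N X}) (kf : forall t, k (f t) = psi_hom c X t) : quadruple c :=
  Quadruple (@quad_mk_gf X Y f k kf) (@quad_mk_fg X Y f k).

Lemma adjoint_mk X Y (f : {linear tensor M X -> Y}) (k : {linear Y -> hom N X}) kf y : adjoint (quad_g (@quad_mk X Y f k kf)) y = k y.
Proof. by apply: hom_ext => n; rewrite adjointE tensor_adjE. Qed.

(** With f the identity for T, or g~ the identity for H, the equation g~ f = [psi_hom] leaves no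
    choice for the other map. *)
Definition quad_T W : quadruple c :=
  @quad_mk W (tensor M W) (idfun : {linear _ -> _}) (psi_hom c W) (fun=> erefl).
Definition quad_H W : quadruple c :=
  @quad_mk W (hom N W) (psi_hom c W) (idfun : {linear _ -> _}) (fun=> erefl).

Lemma quad_Z_subproof V (t : tensor M (zero_module A)) :
  zero_map V (hom N (zero_module A)) (zero_map _ V t) = psi_hom c _ t.
Proof. by apply: hom_ext => n; rewrite [LHS]zero_moduleE [RHS]zero_moduleE. Qed.
Definition quad_Z V : quadruple c := quad_mk (@quad_Z_subproof V).

Lemma adjoint_T W t : adjoint (quad_g (quad_T W)) t = psi_hom c W t.
Proof. exact: adjoint_mk. Qed.
Lemma adjoint_H W h : adjoint (quad_g (quad_H W)) h = h.
Proof. exact: adjoint_mk. Qed.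
Lemma adjoint_Z V y : adjoint (quad_g (quad_Z V)) y = 0.
Proof. exact: adjoint_mk. Qed.

Lemma quad_hom_T W q (s : {linear W -> quad_X q}) :
  @quad_hom A B c (quad_T W) q s (quad_f q \o tensor_map M s : {linear tensor M W -> quad_Y q}).
Proof.
split=> // t; rewrite adjoint_T /= -psi_hom_natural.
by rewrite adjoint_psi.
Qed.

Lemma quad_hom_H W q (r : {linear quad_X q -> W}) :
  @quad_hom A B c q (quad_H W) r
    (hom_comp r \o adjoint (quad_g q) : {linear quad_Y q -> hom N W}).
Proof.
split=> [t|y]; last by rewrite adjoint_H.
by rewrite /= psi_hom_natural adjoint_psi.
Qed.

Lemma quad_hom_Z_l V q (t : {linear V -> quad_Y q}) :
  (forall y, adjoint (quad_g q) (t y) = 0) -> @quad_hom A B c (quad_Z V) q (zero_map _ _) t.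
Proof.
move=> t0; split=> [u|y]; first by rewrite tensor_map0 // [RHS]linear0; exact: linear0.
by rewrite t0; apply: hom_ext.
Qed.

Lemma quad_hom_Z_r V q (t : {linear quad_Y q -> V}) :
  (forall u, t (quad_f q u) = 0) -> @quad_hom A B c q (quad_Z V) (zero_map _ _) t.
Proof.
move=> t0; split=> [u|y]; first by rewrite t0.
by rewrite adjoint_Z; apply: hom_ext => n.
Qed.

(** A section [s] of the first components extends by adjointness to a map from T W; naturality of f
    makes its second component a section too. *)
Lemma quad_T_ext W q : Ext1_eq0 W (quad_X q) -> Ext1_eq0 (quad_module (quad_T W)) (quad_module q).
Proof.
move=> ext; apply: quad_ext_sections => e a b a' b' [_ [hf _] sa sb].
have [s sE] := ext_lift (idfun : {linear W -> W}) ext sa.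
exists s, (quad_f e \o tensor_map M s : {linear _ -> _}); split; [exact: quad_hom_T|exact: sE|].
move=> t; rewrite [LHS]hf /= tensor_map_comp -[RHS]tensor_map_id.
exact: tensor_map_eq.
Qed.

Lemma quad_H_ext W q : Ext1_eq0 (quad_X q) W -> Ext1_eq0 (quad_module q) (quad_module (quad_H W)).
Proof.
move=> ext; apply: quad_ext_retractions => e a b a' b' [[_ hg] _ sa sb].
have [r rE] := ext_extend (idfun : {linear W -> W}) ext sa.
exists r, (hom_comp r \o adjoint (quad_g e) : {linear _ -> _}); split; [exact: quad_hom_H|exact: rE|].
move=> u; rewrite /= -hg adjoint_H; apply: hom_ext => n.
exact: rE.
Qed.

(** An extension of Z V by Z V' has zero first component, so any section of the second components is
    compatible with f and g~. *)
Lemma quad_Z_ext V V' : Ext1_eq0 V V' -> Ext1_eq0 (quad_module (quad_Z V)) (quad_module (quad_Z V')).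
Proof.
move=> ext; apply: quad_ext_sections => e a b a' b' [_ _ [_ sa _] sb].
have e0 (x : quad_X e) : x = 0.
  by have /sa[z <-] : a' x = 0; [exact: zero_moduleE|rewrite (zero_moduleE z) linear0].
have [t tE] := ext_lift (idfun : {linear V -> V}) ext sb.
exists (zero_map _ _), t; split; [|by move=> x; rewrite [RHS]zero_moduleE linear0|exact: tE].
by apply: quad_hom_Z_l => y; apply: hom_ext => n; rewrite [LHS]e0 [RHS]e0.
Qed.

Lemma short_exact_zero_l (R : pzRingType) (U V : lmodType R) (h : {linear U -> V}) :
  bijective h -> short_exact (zero_map (zero_module R) U) h.
Proof.
move=> [k hK kK]; split=> [x y _|x|y]; last by exists (k y).
  by rewrite (zero_moduleE x) (zero_moduleE y).
split=> [x0|[y <-]]; last by rewrite linear0.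
by exists 0; apply: (can_inj hK); rewrite x0 !linear0.
Qed.

Lemma short_exact_zero_r (R : pzRingType) (U V : lmodType R) (h : {linear U -> V}) :
  bijective h -> short_exact h (zero_map V (zero_module R)).
Proof.
move=> [k hK kK]; split=> [|x|y]; first exact: can_inj hK.
  by split=> // _; exists (k x); rewrite kK.
by exists 0; rewrite (zero_moduleE y).
Qed.

Lemma idfun_bij (T : Type) : bijective (@idfun T).
Proof. by exists idfun. Qed.

Lemma quad_coker_exact q : injective (quad_f q) ->
  @quad_short_exact A B c (quad_T (quad_X q)) q (quad_Z (Coker (quad_f q)))
    (idfun : {linear _ -> _}) (quad_f q) (zero_map _ _) (coker_proj (quad_f q)).
Proof.
move=> fi; split.
- have := quad_hom_T (idfun : {linear quad_X q -> quad_X q}).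
  move=> [_ hg]; split=> [t|y]; first by rewrite /= tensor_map_id.
  by rewrite (hg y) /= tensor_map_id.
- by apply: quad_hom_Z_r => u; apply/coker_proj_eq0; exists u.
- exact/short_exact_zero_r/idfun_bij.
- exact: short_exact_coker.
Qed.

Lemma quad_ker_exact q : surjective (adjoint (quad_g q)) ->
  @quad_short_exact A B c (quad_Z (Ker (adjoint (quad_g q)))) q (quad_H (quad_X q))
    (zero_map _ _) (val : {linear Ker (adjoint (quad_g q)) -> quad_Y q})
    (idfun : {linear _ -> _}) (adjoint (quad_g q)).
Proof.
move=> gs; split.
- by apply: quad_hom_Z_l => y; exact: Ker_val.
- have [hf _] := quad_hom_H (idfun : {linear quad_X q -> quad_X q}).
  split=> [t|y]; last by rewrite adjoint_H; apply: hom_ext.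
  by rewrite -(hf t); apply: hom_ext.
- exact/short_exact_zero_l/idfun_bij.
- exact: short_exact_Ker.
Qed.

Lemma quad_T_exact X (E : lmodType A) W (i : {linear X -> E}) (p : {linear E -> W}) :
    Tor1_eq0 M W -> short_exact i p ->
  @quad_short_exact A B c (quad_T X) (quad_T E) (quad_T W) i (tensor_map M i) p (tensor_map M p).
Proof.
move=> tor se; have [ii ip ps] := se; split=> //.
- by split=> // t; rewrite !adjoint_T psi_hom_natural.
- by split=> // t; rewrite !adjoint_T psi_hom_natural.
split; [exact: tor_injective tor se|exact: tensor_right_exact|exact: tensor_map_surjective].
Qed.

Lemma quad_H_exact X (E : lmodType A) W (i : {linear X -> E}) (p : {linear E -> W}) :
    Ext1_eq0 N X -> short_exact i p ->
  @quad_short_exact A B c (quad_H X) (quad_H E) (quad_H W)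
    i (hom_comp i : {linear hom N X -> hom N E}) p (hom_comp p : {linear hom N E -> hom N W}).
Proof.
move=> ext se; split=> //; last exact: hom_short_exact.
- by split=> [t|y]; rewrite ?adjoint_H //= psi_hom_natural.
- by split=> [t|y]; rewrite ?adjoint_H //= psi_hom_natural.
Qed.

Lemma quad_Z_exact Y (E : lmodType B) V (i : {linear Y -> E}) (p : {linear E -> V}) : short_exact i p ->
  @quad_short_exact A B c (quad_Z Y) (quad_Z E) (quad_Z V) (zero_map _ _) i (zero_map _ _) p.
Proof.
move=> se; split=> //.
- by apply: quad_hom_Z_l => y; rewrite adjoint_Z.
- by apply: quad_hom_Z_l => y; rewrite adjoint_Z.
split=> [x y _|x|y]; first by rewrite (zero_moduleE x) (zero_moduleE y).
  by split=> // _; exists 0; rewrite (zero_moduleE x).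
by exists 0; rewrite (zero_moduleE y).
Qed.
End Functors.

(** * Cotorsion pairs *)

Section CotorsionPairs.
Context (R : pzRingType) (C D : lmodType R -> Prop) (cot : cotorsion_pair C D).
Implicit Types K E U V W X Y : lmodType R.

Lemma cotorsion_ext U X : C U -> D X -> Ext1_eq0 U X.
Proof. by case: cot => CD _ CU /CD; apply. Qed.

Lemma cotorsion_l_intro U : (forall X, D X -> Ext1_eq0 U X) -> C U.
Proof. by case: cot => _ DC h; apply/DC. Qed.

Lemma cotorsion_r_intro X : (forall U, C U -> Ext1_eq0 U X) -> D X.
Proof. by case: cot => CD _ h; apply/CD. Qed.

(** Closure under isomorphism is inherited from being a left perp. *)
Lemma cotorsion_l_iso U V : isomorphic U V -> C U -> C V.
Proof.
move=> UV CU; apply: cotorsion_l_intro => X DX.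
exact: ext_iso UV (isomorphic_refl X) (cotorsion_ext CU DX).
Qed.

Lemma cotorsion_r_iso X Y : isomorphic X Y -> D X -> D Y.
Proof.
move=> XY DX; apply: cotorsion_r_intro => U CU.
exact: ext_iso (isomorphic_refl U) XY (cotorsion_ext CU DX).
Qed.

Lemma cotorsion_l_zero U : (forall u : U, u = 0) -> C U.
Proof. by move=> U0; apply: cotorsion_l_intro => X _; exact: ext_zero_l. Qed.

Lemma cotorsion_r_zero X : (forall x : X, x = 0) -> D X.
Proof. by move=> X0; apply: cotorsion_r_intro => U _; exact: ext_zero_r. Qed.

Lemma cotorsion_l_extension K U V (i : {linear K -> U}) (p : {linear U -> V}) :
  short_exact i p -> C K -> C V -> C U.
Proof.
move=> se CK CV; apply: cotorsion_l_intro => X DX.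
exact: ext_extl se (cotorsion_ext CK DX) (cotorsion_ext CV DX).
Qed.

Lemma cotorsion_r_extension K U V (i : {linear K -> U}) (p : {linear U -> V}) :
  short_exact i p -> D K -> D V -> D U.
Proof.
move=> se DK DV; apply: cotorsion_r_intro => X CX.
exact: ext_extr se (cotorsion_ext CX DK) (cotorsion_ext CX DV).
Qed.
End CotorsionPairs.

(** * The two classes of modules over the Morita ring *)

Section MoritaCotorsion.
Context (A B : pzRingType) (c : morita_context A B).
Context (U X : lmodType A -> Prop) (V Y : lmodType B -> Prop).
Hypotheses (cotUX : cotorsion_pair U X) (cotVY : cotorsion_pair V Y).
Local Notation M := (mctx_M c).
Local Notation N := (mctx_N c).
Hypothesis MN0 : forall t : tensor M N, t = 0.
Local Notation quad_T := (quad_T MN0).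
Local Notation quad_H := (quad_H MN0).
Local Notation quad_Z := (quad_Z MN0).
Local Notation classM := (class_M c U V).
Local Notation classN := (class_N c X Y).
Implicit Types (q e : quadruple c) (W : lmodType A) (L : lmodType (morita_ring c)).

Lemma class_M_iso L L' : isomorphic L L' -> classM L -> classM L'.
Proof.
move=> LL' [q [Lq h]]; exists q; split=> //.
exact: isomorphic_trans (isomorphic_sym LL') Lq.
Qed.

Lemma class_N_iso L L' : isomorphic L L' -> classN L -> classN L'.
Proof.
move=> LL' [q [Lq h]]; exists q; split=> //.
exact: isomorphic_trans (isomorphic_sym LL') Lq.
Qed.

Lemma class_M_quad q : V (Coker (quad_f q)) -> U (quad_X q) -> injective (quad_f q) ->
  classM (quad_module q).
Proof. by move=> hV hU fi; exists q; split; [exact: isomorphic_refl|]. Qed.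

Lemma class_N_quad q : Y (Ker (adjoint (quad_g q))) -> X (quad_X q) ->
  surjective (adjoint (quad_g q)) -> classN (quad_module q).
Proof. by move=> hY hX gs; exists q; split; [exact: isomorphic_refl|]. Qed.

Lemma class_M_T W : U W -> classM (quad_module (quad_T W)).
Proof.
move=> UW; apply: class_M_quad => //; apply: (cotorsion_l_zero cotVY) => u.
have [t <-] := coker_proj_surjective u; apply/coker_proj_eq0; by exists t.
Qed.

Lemma class_N_H W : X W -> classN (quad_module (quad_H W)).
Proof.
move=> XW; apply: class_N_quad => // [|h]; last by exists h; rewrite adjoint_H.
apply: (cotorsion_r_zero cotVY) => k; apply: val_inj.
by rewrite -[LHS]adjoint_H; exact: Ker_val.
Qed.

Lemma class_M_Z (V' : lmodType B) : V V' -> classM (quad_module (quad_Z V')).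
Proof.
move=> VV; apply: class_M_quad.
- apply: (cotorsion_l_iso cotVY _ VV); apply: isomorphic_sym.
  apply: (@isomorphic_Coker _ _ _ _ _ (idfun : {linear V' -> V'})).
  split=> [t t' _|v|v]; last by exists v.
    have t0 (s : tensor M (zero_module A)) : s = 0.
      rewrite -[s]tensor_map_id; apply: tensor_map0 => x; exact: zero_moduleE.
    by rewrite (t0 t) (t0 t').
  by split=> [v0|[t <-]//]; exists 0; rewrite -[RHS]/(idfun v) v0.
- by apply: (cotorsion_l_zero cotUX); exact: zero_moduleE.
move=> t t' _; have t0 (s : tensor M (zero_module A)) : s = 0.
  rewrite -[s]tensor_map_id; apply: tensor_map0 => x; exact: zero_moduleE.
by rewrite (t0 t) (t0 t').
Qed.

Lemma class_N_Z (Y' : lmodType B) : Y Y' -> classN (quad_module (quad_Z Y')).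
Proof.
move=> YY.
have gs : surjective (adjoint (quad_g (quad_Z Y'))).
  by move=> h; exists 0; apply: hom_ext => n; rewrite [LHS]zero_moduleE [RHS]zero_moduleE.
apply: class_N_quad => //.
- apply: (cotorsion_r_iso cotVY _ YY).
  apply: (@isomorphic_Ker _ _ _ _ (idfun : {linear Y' -> Y'})).
  split=> // v; split=> _; last exact: adjoint_Z.
  by exists v.
- by apply: (cotorsion_r_zero cotUX); exact: zero_moduleE.
Qed.

Lemma ext_T_class_N W L : U W -> classN L -> Ext1_eq0 (quad_module (quad_T W)) L.
Proof.
move=> UW [q [/isomorphic_sym qL [_ Xq _]]].
apply: (ext_iso (isomorphic_refl _) qL); apply: quad_T_ext.
exact: (cotorsion_ext cotUX).
Qed.

Lemma ext_Z_class_N (V' : lmodType B) L : V V' -> classN L -> Ext1_eq0 (quad_module (quad_Z V')) L.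
Proof.
move=> VV [q [/isomorphic_sym qL [Yq Xq gs]]].
apply: (ext_iso (isomorphic_refl _) qL); apply: (quad_ext_extr (quad_ker_exact MN0 gs)).
  by apply: quad_Z_ext; exact: (cotorsion_ext cotVY).
by apply: quad_H_ext; apply: ext_zero_l; exact: zero_moduleE.
Qed.

Lemma ext_class_M_H W L : X W -> classM L -> Ext1_eq0 L (quad_module (quad_H W)).
Proof.
move=> XW [q [/isomorphic_sym qL [_ Uq _]]].
apply: (ext_iso qL (isomorphic_refl _)); apply: quad_H_ext.
exact: (cotorsion_ext cotUX).
Qed.

Lemma ext_class_M_Z (Y' : lmodType B) L : Y Y' -> classM L -> Ext1_eq0 L (quad_module (quad_Z Y')).
Proof.
move=> YY [q [/isomorphic_sym qL [Vq Uq fi]]].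
apply: (ext_iso qL (isomorphic_refl _)); apply: (quad_ext_extl (quad_coker_exact MN0 fi)).
  by apply: quad_T_ext; apply: ext_zero_r; exact: zero_moduleE.
by apply: quad_Z_ext; exact: (cotorsion_ext cotVY).
Qed.

(** Only [L] is filtered, by T X and Z (Coker f); the class of [L'] enters through its orthogonality
    to these two pieces. *)
Lemma ext_class_M_class_N L L' : classM L -> classN L' -> Ext1_eq0 L L'.
Proof.
move=> [q [/isomorphic_sym qL [Vq Uq fi]]] NL'.
have [q' [/isomorphic_sym qL' _]] := NL'.
apply: (ext_iso qL (isomorphic_refl _)).
have [h [k [se _ _]]] := quad_short_exact_linear (quad_coker_exact MN0 fi).
by apply: (ext_extl se); [exact: ext_T_class_N|exact: ext_Z_class_N].
Qed.

(** Given [h] in Hom(N, X), enlarge Y to Y x B and let g~ send (0, 1) to [h]. This is an extension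
    of Z B by [q]; a retraction onto [q] is the identity on X, so it sends (0, 1) to a preimage of
    [h]. *)
Lemma adjoint_surjective_of_ext q :
    Ext1_eq0 (quad_module (quad_Z (B^o : lmodType B))) (quad_module q) ->
  surjective (adjoint (quad_g q)).
Proof.
move=> ext h; pose F := (quad_Y q * B^o)%type.
have [i iE] := @linear_map B (quad_Y q) F (fun y => (y, 0))
  ltac:(by move=> a x y; congr pair; rewrite /= scaler0 addr0).
have [k kE] := @linear_map B F (hom N (quad_X q)) (fun z => adjoint (quad_g q) z.1 + (z.2 : B) *: h)
  ltac:(by move=> a x y; rewrite /= linearP scalerDl scalerDr scalerA addrACA).
have kf t : k ((i \o quad_f q : {linear _ -> _}) t) = psi_hom c (quad_X q) t.
  by rewrite kE /= iE /= scale0r addr0 adjoint_psi.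
pose e := quad_mk MN0 kf.
have ek z : adjoint (quad_g e) z = k z by exact: adjoint_mk.
have se : @quad_short_exact A B c q e (quad_Z B^o) (idfun : {linear _ -> _}) i
    (zero_map _ _) (snd : {linear F -> B^o}).
  split.
  - split=> [t|y]; first by rewrite tensor_map_id.
    by rewrite ek kE iE /= scale0r addr0; apply: hom_ext.
  - by apply: quad_hom_Z_r => u; rewrite /= iE.
  - exact/short_exact_zero_r/idfun_bij.
  split=> [y y'|[y b]|b]; [by rewrite !iE => -[]| |by exists (0, b)].
  by split=> /= [->|[y']]; [exists y; rewrite iE|rewrite iE => -[_ <-]].
have qid : @quad_hom A B c q q (idfun : {linear _ -> _}) (idfun : {linear _ -> _}).
  by split=> [t|y]; [rewrite tensor_map_id|apply: hom_ext].
have [u [v [[_ uv] uE vE]]] := quad_ext_extend ext se qid.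
exists (v (0, 1)); rewrite -uv ek kE /= scale1r linear0 add0r.
by apply: hom_ext => n; rewrite hom_compE [LHS]uE.
Qed.

(** If f kills [t] but a character [h] does not, enlarge Y to Y x I and replace f by (f, h). This is
    an extension of [q] by the Z of an injective; a section that is the identity on X sends f(t) = 0
    to (0, h t), so h t = 0. *)
Lemma injective_of_ext q :
    Ext1_eq0 (quad_module q) (quad_module (quad_Z (character_module B))) ->
  injective (quad_f q).
Proof.
move=> ext; apply: linear_inj => t ft; apply: contrapT => /character_cogenerator[h]; apply.
set I := character_module B in h ext *; pose F := (quad_Y q * I)%type.
have [j jE] := @linear_map B I F (fun y => (0, y))
  ltac:(by move=> a x y; congr pair; rewrite /= scaler0 addr0).
have [f fE] := @linear_map B (tensor M (quad_X q)) F (fun t => (quad_f q t, h t))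
  ltac:(by move=> a x y; rewrite /= !linearP).
pose k : {linear F -> hom N (quad_X q)} := (adjoint (quad_g q) \o fst : {linear F -> hom N (quad_X q)}).
have kf s : k (f s) = psi_hom c (quad_X q) s by rewrite /k /= fE adjoint_psi.
pose e := quad_mk MN0 kf.
have ek z : adjoint (quad_g e) z = k z by exact: adjoint_mk.
have se : @quad_short_exact A B c (quad_Z I) e q (zero_map _ _) j
    (idfun : {linear _ -> _}) (fst : {linear F -> quad_Y q}).
  split.
  - by apply: quad_hom_Z_l => y; rewrite ek /k /= jE linear0.
  - split=> [s|z]; first by rewrite tensor_map_id /= fE.
    by rewrite ek; apply: hom_ext.
  - exact/short_exact_zero_l/idfun_bij.
  split=> [y y'|[y b]|y]; [by rewrite !jE => -[]| |by exists (y, 0)].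
  by split=> /= [->|[y']]; [exists b; rewrite jE|rewrite jE => -[<- _]].
have qid : @quad_hom A B c q q (idfun : {linear _ -> _}) (idfun : {linear _ -> _}).
  by split=> [s|y]; [rewrite tensor_map_id|apply: hom_ext].
have [u [v [[uv _] uE vE]]] := quad_ext_lift ext se qid.
have := uv t; rewrite ft linear0 (tensor_map_eq (k := (idfun : {linear _ -> _})) uE) tensor_map_id.
by rewrite [RHS]fE => -[_ <-].
Qed.

Hypothesis torU : forall W, U W -> Tor1_eq0 M W.

Lemma class_N_of_ext L :
    (forall W, U W -> Ext1_eq0 (quad_module (quad_T W)) L) ->
    (forall V', V V' -> Ext1_eq0 (quad_module (quad_Z V')) L) ->
  classN L.
Proof.
move=> extT extZ; have [q Lq] := quad_of L.
apply: (class_N_iso (isomorphic_sym Lq)).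
have {}extT W : U W -> Ext1_eq0 (quad_module (quad_T W)) (quad_module q).
  by move=> /extT; exact: ext_iso (isomorphic_refl _) Lq.
have {}extZ V' : V V' -> Ext1_eq0 (quad_module (quad_Z V')) (quad_module q).
  by move=> /extZ; exact: ext_iso (isomorphic_refl _) Lq.
apply: class_N_quad.
(* An extension of the inclusion of Z (Ker g~) into [q] still lands in Ker g~, because g~ vanishes
   on its source; this gives a retraction. *)
- apply: (cotorsion_r_intro cotVY) => V' VV; apply: split_ext => E i p se.
  have zq : @quad_hom A B c (quad_Z (Ker (adjoint (quad_g q)))) q (zero_map _ _)
      (val : {linear Ker (adjoint (quad_g q)) -> quad_Y q}).
    by apply: quad_hom_Z_l => k; exact: Ker_val.
  have [u [v [[_ uv] _ vE]]] := quad_ext_extend (extZ _ VV) (quad_Z_exact MN0 se) zq.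
  have [|r rE] := @factor_through_mono _ _ _ _
    (val : {linear Ker (adjoint (quad_g q)) -> quad_Y q}) v val_inj.
    move=> y; apply/Ker_ex/(etrans (esym (uv y))); rewrite adjoint_Z; apply: hom_ext => n.
    by rewrite hom_compE [LHS]linear0.
  apply: (section_of_retraction (r := r) se) => k.
  by apply: val_inj; rewrite [LHS]rE vE.
(* The Tor hypothesis keeps the sequence exact under T, and the first component of the extended
   counit is a retraction of [i]. *)
- apply: (cotorsion_r_intro cotUX) => W UW; apply: split_ext => E i p se.
  have [u [v [_ uE _]]] := quad_ext_extend (extT _ UW) (quad_T_exact MN0 (torU UW) se)
    (quad_hom_T MN0 (idfun : {linear quad_X q -> quad_X q})).
  exact: (section_of_retraction (r := u) se).
apply: adjoint_surjective_of_ext; apply: extZ.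
by apply: (cotorsion_l_intro cotVY) => Z _; exact/ext_projective/regular_projective.
Qed.

(** The left perp of the class contains the T U and the Z V, so a module in its right perp passes
    the tests of [class_N_of_ext]. *)
Lemma cotorsion_perp_class_N : cotorsion_pair (left_perp classN) classN.
Proof.
split=> // L; split=> [LN|NL W]; last exact.
apply: class_N_of_ext => [W UW|V' VV]; apply: LN => L' NL'.
  exact: ext_T_class_N.
exact: ext_Z_class_N.
Qed.

Hypothesis extX : forall W, X W -> Ext1_eq0 N W.

Lemma class_M_of_ext L :
    (forall W, X W -> Ext1_eq0 L (quad_module (quad_H W))) ->
    (forall Y', Y Y' -> Ext1_eq0 L (quad_module (quad_Z Y'))) ->
  classM L.
Proof.
move=> extH extZ; have [q Lq] := quad_of L.
apply: (class_M_iso (isomorphic_sym Lq)).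
have {}extH W : X W -> Ext1_eq0 (quad_module q) (quad_module (quad_H W)).
  by move=> /extH; exact: ext_iso Lq (isomorphic_refl _).
have {}extZ Y' : Y Y' -> Ext1_eq0 (quad_module q) (quad_module (quad_Z Y')).
  by move=> /extZ; exact: ext_iso Lq (isomorphic_refl _).
apply: class_M_quad.
(* A lift of [q] -> Z (Coker f) has zero first component, so its second component kills the image of
   f and descends to a section on Coker f. *)
- apply: (cotorsion_l_intro cotVY) => Y' YY; apply: split_ext => E i p se.
  have qz : @quad_hom A B c q (quad_Z (Coker (quad_f q))) (zero_map _ _) (coker_proj (quad_f q)).
    by apply: quad_hom_Z_r => t; apply/coker_proj_eq0; exists t.
  have [u [v [[uv _] _ vE]]] := quad_ext_lift (extZ _ YY) (quad_Z_exact MN0 se) qz.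
  have [|s sE] := @factor_through_epi _ _ _ _ (coker_proj (quad_f q)) v
    (@coker_proj_surjective _ _ _ _).
    by move=> y /coker_proj_eq0[t <-]; rewrite uv.
  by exists s => k; have [y <-] := coker_proj_surjective k; rewrite [s _]sE [LHS]vE.
(* Ext vanishing against N keeps the sequence exact under H; the first component of the lifted unit
   is a section of [p]. *)
- apply: (cotorsion_l_intro cotUX) => W XW; apply: split_ext => E i p se.
  have [u [v [_ uE _]]] := quad_ext_lift (extH _ XW) (quad_H_exact MN0 (extX XW) se)
    (quad_hom_H MN0 (idfun : {linear quad_X q -> quad_X q})).
  by exists u.
apply: injective_of_ext; apply: extZ.
by apply: (cotorsion_r_intro cotVY) => Z _; exact: character_injective.
Qed.

Lemma cotorsion_class_M_perp : cotorsion_pair classM (right_perp classM).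
Proof.
split=> // L; split=> [LN|NL W]; last exact.
apply: class_M_of_ext => [W XW|Y' YY]; apply: LN => L' NL'.
  exact: ext_class_M_H.
exact: ext_class_M_Z.
Qed.

Lemma cotorsion_class_M_class_N : cotorsion_pair classM classN.
Proof.
split=> L; split.
- move=> LM; apply: class_N_of_ext => [W UW|V' VV]; apply: LM.
    exact: class_M_T.
  exact: class_M_Z.
- by move=> NL L' ML'; exact: ext_class_M_class_N.
- move=> LN; apply: class_M_of_ext => [W XW|Y' YY]; apply: LN.
    exact: class_N_H.
  exact: class_N_Z.
- by move=> ML L' NL'; exact: ext_class_M_class_N.
Qed.

(** * Hereditary pairs *)

Hypotheses (hereditaryUX : hereditary_pair U X) (hereditaryVY : hereditary_pair V Y).

(** The Tor hypothesis makes M (x) a injective, hence f1 is injective because f2 is. Since f3 is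
    injective too, the snake lemma makes the sequence of cokernels short exact, and the hereditary
    hypothesis on V applies. *)
Lemma quad_hereditary_l q1 q2 q3 a b a' b' : @quad_short_exact A B c q1 q2 q3 a b a' b' ->
    [/\ V (Coker (quad_f q2)), U (quad_X q2) & injective (quad_f q2)] ->
    [/\ V (Coker (quad_f q3)), U (quad_X q3) & injective (quad_f q3)] ->
  classM (quad_module q1).
Proof.
move=> [[hf _] [hf' _] sa sb] [V2 U2 f2] [V3 U3 f3].
have [ai aa as'] := sa; have [bi bb bs] := sb.
have f1 : injective (quad_f q1).
  move=> t t' e; apply: (tor_injective (torU U3) sa); apply: f2.
  by rewrite -!hf e.
apply: class_M_quad => //; last first.
  apply: (cotorsion_l_iso cotUX (isomorphic_sym (isomorphic_Ker sa))).
  by case: hereditaryUX => + _; apply.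
pose p1 : {linear _ -> Coker (quad_f q1)} := coker_proj (quad_f q1).
pose p2 : {linear _ -> Coker (quad_f q2)} := coker_proj (quad_f q2).
pose p3 : {linear _ -> Coker (quad_f q3)} := coker_proj (quad_f q3).
have [|i iE] := @factor_through_epi _ _ _ _ p1 (p2 \o b : {linear _ -> _}) (@coker_proj_surjective _ _ _ _).
  by move=> y /coker_proj_eq0[t <-] /=; apply/coker_proj_eq0; exists (tensor_map M a t); rewrite hf.
have [|p pE] := @factor_through_epi _ _ _ _ p2 (p3 \o b' : {linear _ -> _}) (@coker_proj_surjective _ _ _ _).
  by move=> y /coker_proj_eq0[t <-] /=; apply/coker_proj_eq0; exists (tensor_map M a' t); rewrite hf'.
have se : short_exact i p.
  split=> [|k|k].
  - apply: linear_inj => k; have [y <-] := coker_proj_surjective k.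
    rewrite -/(p1 y) iE => /coker_proj_eq0[t tE]; apply/coker_proj_eq0.
    (* If b y = f2 t, injectivity of f3 forces [t] to come from some [s] over the first term, and
       then f1 s = y. *)
    have /(tensor_right_exact aa as')[s sE] : tensor_map M a' t = 0.
      by apply: f3; rewrite -hf' tE linear0; apply/bb; exists y.
    by exists s; apply: bi; rewrite hf /= -tE -sE.
  - have [y <-] := coker_proj_surjective k; rewrite -/(p2 y) pE; split; last first.
      move=> [k1]; have [y1 <-] := coker_proj_surjective k1; rewrite -/(p1 y1) iE /=.
      move=> e; have {}e : p2 (b y1) = p2 y := e.
      by rewrite -[LHS]pE -e pE /= (short_exact_comp0 _ sb); exact: linear0.
    move=> /coker_proj_eq0[t tE].
    have [s sE] := @tensor_map_surjective _ _ M _ _ _ as' t.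
    have /bb[y1 y1E] : b' (y - quad_f q2 s) = 0.
      by rewrite linearB hf' sE tE subrr.
    exists (p1 y1); rewrite iE /= y1E linearB -[RHS]subr0; congr (_ - _).
    by apply/coker_proj_eq0; exists s.
  have [y <-] := coker_proj_surjective k; have [y2 <-] := bs y.
  by exists (p2 y2); rewrite pE.
apply: (cotorsion_l_iso cotVY (isomorphic_sym (isomorphic_Ker se))).
by case: hereditaryVY => + _; apply=> //; case: se.
Qed.

(** Ext vanishing on N and X1 makes Hom(N, -) exact on the first components; surjectivity of g~ on
    the first term makes the sequence of kernels of g~ short exact. *)
Lemma quad_hereditary_r q1 q2 q3 a b a' b' : @quad_short_exact A B c q1 q2 q3 a b a' b' ->
    [/\ Y (Ker (adjoint (quad_g q1))), X (quad_X q1) & surjective (adjoint (quad_g q1))] ->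
    [/\ Y (Ker (adjoint (quad_g q2))), X (quad_X q2) & surjective (adjoint (quad_g q2))] ->
  classN (quad_module q3).
Proof.
move=> [[_ hg] [_ hg'] sa sb] [Y1 X1 g1] [Y2 X2 g2].
have [ai aa as'] := sa; have [bi bb bs] := sb.
have [hi ha hs] := hom_short_exact (extX X1) sa.
apply: class_N_quad => //.
- pose v1 := (val : {linear Ker (adjoint (quad_g q1)) -> quad_Y q1}).
  pose v2 := (val : {linear Ker (adjoint (quad_g q2)) -> quad_Y q2}).
  pose v3 := (val : {linear Ker (adjoint (quad_g q3)) -> quad_Y q3}).
  have [|i iE] := @factor_through_mono _ _ _ _ v2 (b \o v1 : {linear _ -> _}) val_inj.
    by move=> k; apply/Ker_ex/(etrans (esym (hg _))); rewrite [adjoint _ _]Ker_val; exact: linear0.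
  have [|p pE] := @factor_through_mono _ _ _ _ v3 (b' \o v2 : {linear _ -> _}) val_inj.
    by move=> k; apply/Ker_ex/(etrans (esym (hg' _))); rewrite [adjoint _ _]Ker_val; exact: linear0.
  have se : short_exact i p.
    split=> [k k' e|k|k].
    + by apply/val_inj/bi; rewrite -[LHS]iE e iE.
    + split=> [k0|[k1 <-]]; last first.
        apply: val_inj; rewrite [LHS]pE; apply: etrans (congr1 b' (iE k1)) _.
        exact: short_exact_comp0 sb.
      have /bb[y yE] : b' (v2 k) = 0 by rewrite -[LHS]pE k0 linear0.
      have [|k1 k1E] := @Ker_ex _ _ _ (adjoint (quad_g q1)) y.
        apply: hi; rewrite [LHS]hg yE [RHS]linear0; exact: (Ker_val k).
      by exists k1; apply: val_inj; rewrite [LHS]iE; apply: etrans (congr1 b k1E) _.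
    (* A lift [y] of [k] need not lie in Ker g~; its defect comes from Hom(N, X1), and surjectivity
       of g~ there gives the correction b y1. *)
    have [y yE] := bs (v3 k).
    have /ha[h hE] : hom_comp a' (adjoint (quad_g q2) y) = 0.
      by rewrite hg' yE; exact: (Ker_val k).
    have [y1 y1E] := g1 h.
    have [|k2 k2E] := @Ker_ex _ _ _ (adjoint (quad_g q2)) (y - b y1).
      by rewrite linearB -[X in _ - X]hg y1E [X in _ - X]hE subrr.
    exists k2; apply: val_inj; rewrite [LHS]pE; apply: etrans (congr1 b' k2E) _.
    by rewrite linearB yE (short_exact_comp0 _ sb) subr0.
  apply: (cotorsion_r_iso cotVY (isomorphic_Coker se)).
  by case: hereditaryVY => _; apply=> //; case: se.
- apply: (cotorsion_r_iso cotUX (isomorphic_Coker sa)).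
  by case: hereditaryUX => _; apply.
move=> w; have [v <-] := hs w; have [y <-] := g2 v.
by exists (b' y); rewrite -[LHS]hg'.
Qed.

Lemma class_hereditary : hereditary_pair classM classN.
Proof.
split=> [L L' p [q [Lq cq]] [q' [Lq' cq']] ps|L L' i [q [Lq cq]] [q' [Lq' cq']] ii].
  have [k Kk] := quad_of (Ker p).
  have [i' [p' se]] := short_exact_isomorphic Kk Lq Lq' (short_exact_Ker ps).
  have [a [b [a' [b' [se' _ _]]]]] := linear_quad_short_exact se.
  by apply: (class_M_iso (isomorphic_sym Kk)); exact: quad_hereditary_l se' cq cq'.
have [k Kk] := quad_of (Coker i).
have [i' [p' se]] := short_exact_isomorphic Lq Lq' Kk (short_exact_coker ii).
have [a [b [a' [b' [se' _ _]]]]] := linear_quad_short_exact se.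
by apply: (class_N_iso (isomorphic_sym Kk)); exact: quad_hereditary_r se' cq cq'.
Qed.

(** * Complete pairs *)

Hypotheses (completeUX : complete_pair U X) (completeVY : complete_pair V Y).

(** Only Y changes: f is composed with Y -> F and g~ is replaced by F -> Hom(N, X), which preserves
    their composite. The cokernel is therefore Z of the cokernel of Y -> F. *)
Lemma quad_complete_r q : X (quad_X q) ->
  exists e (V' : lmodType B) a b a' b',
    [/\ @quad_short_exact A B c q e (quad_Z V') a b a' b', V V' & classN (quad_module e)].
Proof.
move=> Xq; have [F [V' [Y' [i [pi [j [p [[VV YY] sei sej pE]]]]]]]] :=
  complete_pair_factor (@cotorsion_l_extension _ _ _ cotVY) completeVY (adjoint (quad_g q)).
have kf t : p ((i \o quad_f q : {linear _ -> _}) t) = psi_hom c (quad_X q) t.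
  by rewrite /= pE; exact: adjoint_psi.
pose e := quad_mk MN0 kf.
have ek z : adjoint (quad_g e) z = p z by exact: adjoint_mk.
have seY : short_exact (j : {linear Y' -> quad_Y e}) (adjoint (quad_g e)).
  have [ji jp ps] := sej; split=> // [x|x]; last by have [y <-] := ps x; exists y; exact: ek.
  by split=> [e0|/jp e0]; [apply/jp; rewrite -[LHS]ek|exact: etrans (ek x) e0].
exists e, V', (idfun : {linear _ -> _}), i, (zero_map _ _), pi; split=> //.
  split=> //; last exact/short_exact_zero_r/idfun_bij.
  - split=> [t|y]; first by rewrite tensor_map_id.
    by rewrite ek pE; apply: hom_ext.
  - by apply: quad_hom_Z_r => t; exact: short_exact_comp0 sei.
apply: class_N_quad => //; last by case: seY.
exact: (cotorsion_r_iso cotVY (isomorphic_Ker seY)).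
Qed.

Lemma quad_complete_l q : U (quad_X q) ->
  exists e (Y' : lmodType B) a b a' b',
    [/\ @quad_short_exact A B c (quad_Z Y') e q a b a' b', Y Y' & classM (quad_module e)].
Proof.
move=> Uq; have [F [V' [Y' [i [pi [j [p [[VV YY] sei sej pE]]]]]]]] :=
  complete_pair_factor (@cotorsion_l_extension _ _ _ cotVY) completeVY (quad_f q).
have kf t : (adjoint (quad_g q) \o p : {linear _ -> _}) (i t) = psi_hom c (quad_X q) t.
  by rewrite /= pE; exact: adjoint_psi.
pose e := quad_mk MN0 kf.
have ek z : adjoint (quad_g e) z = adjoint (quad_g q) (p z) by exact: adjoint_mk.
exists e, Y', (zero_map _ _), j, (idfun : {linear _ -> _}), p; split=> //.
  split=> //; last exact/short_exact_zero_l/idfun_bij.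
  - by apply: quad_hom_Z_l => y; rewrite ek (short_exact_comp0 _ sej) linear0.
  - split=> [t|y]; first by rewrite tensor_map_id pE.
    by rewrite ek; apply: hom_ext.
apply: class_M_quad => //; last by case: sei.
exact: (cotorsion_l_iso cotVY (isomorphic_sym (isomorphic_Coker sei))).
Qed.

Lemma class_complete_r q : exists (D2 C2 : lmodType (morita_ring c))
    (i : {linear quad_module q -> D2}) (p : {linear D2 -> C2}),
  [/\ classM C2, classN D2 & short_exact i p].
Proof.
have [_ [X2 [U2 [i [p [UU XX se]]]]]] := completeUX (quad_X q).
have [h [k [seT hE kE]]] := quad_short_exact_linear (quad_T_exact MN0 (torU UU) se).
have [w wE] := quad_hom_linear (quad_hom_T MN0 (idfun : {linear quad_X q -> quad_X q})).
have [Q [j [s [l [seQ lh sl]]]]] := short_exact_pushout w seT.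
have [e [u [u' [uK u'K [a [b [a' [b' [see jE sE]]]]]]]]] := quad_short_exact_middle seQ.
have [u1 u1E] := @linear_map _ Q (quad_module e) u ltac:(by move=> r x y; rewrite linearP).
have [v [v' [_ vE]]] := linear_quad_hom (u1 \o l : {linear _ -> _}).
have [_ _ sea _] := see.
(* The counit is the identity on first components, so there the pushout changes nothing: X(e) is
   identified with [X2]. *)
have vb : bijective v.
  apply: (short_five (a := idfun) (x := (idfun : {linear U2 -> U2})) se sea).
  - exact: idfun_bij.
  - exact: idfun_bij.
  - by move=> x; have := vE (h (x, 0)); rewrite [LHS]u1E /= lh jE wE hE => -[].
  move=> x; have := sE (u (l (x, 0))); rewrite uK sl kE => -[e1 _].
  by rewrite [RHS]e1 -u1E; have /= -> := vE (x, 0).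
have Xe : X (quad_X e) by apply: (cotorsion_r_iso cotUX _ XX); exists v.
have [e2 [V' [a2 [b2 [a2' [b2' [see2 VV Ne2]]]]]]] := quad_complete_r Xe.
have [f [f' [sef _ _]]] := quad_short_exact_linear see.
have [g [g' [seg _ _]]] := quad_short_exact_linear see2.
(* The cokernel of the composite embedding is an extension of Z V' by T U2, both in the left
   class. *)
have [gf [f3 [g3 [se3 _]]]] := short_exact_coker_comp sef seg.
exists (quad_module e2), (Coker (g \o f : {linear _ -> _})), (g \o f : {linear _ -> _}),
  (coker_proj _ : {linear _ -> _}); split=> //; last exact: short_exact_coker.
apply: (cotorsion_l_extension cotorsion_class_M_class_N se3).
  exact: class_M_T.
exact: class_M_Z.
Qed.

Lemma class_complete_l q : exists (D1 C1 : lmodType (morita_ring c))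
    (i : {linear D1 -> C1}) (p : {linear C1 -> quad_module q}),
  [/\ classM C1, classN D1 & short_exact i p].
Proof.
have [[X1 [U1 [i [p [UU XX se]]]]] _] := completeUX (quad_X q).
have [h [k [seH hE kE]]] := quad_short_exact_linear (quad_H_exact MN0 (extX XX) se).
have [w wE] := quad_hom_linear (quad_hom_H MN0 (idfun : {linear quad_X q -> quad_X q})).
have [Q [j [s [l [seQ lj ws]]]]] := short_exact_pullback w seH.
have [e [u [u' [uK u'K [a [b [a' [b' [see jE sE]]]]]]]]] := quad_short_exact_middle seQ.
have [v [v' [_ vE]]] := linear_quad_hom (l \o u' : {linear _ -> _}).
have [_ _ sea _] := see.
(* The unit is the identity on first components, so the pullback has first component [U1] up to
   isomorphism. *)
have vb : bijective v.
  apply: (short_five (a := idfun) (x := (idfun : {linear quad_X q -> quad_X q})) sea se).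
  - exact: idfun_bij.
  - exact: idfun_bij.
  - by move=> x; have := vE (u (j (x, 0))); rewrite [LHS]/= uK lj hE jE => -[->].
  move=> x; have := ws (u' (x, 0)); rewrite sE wE kE /=.
  by have /= -> := vE (x, 0) => -[].
have Ue : U (quad_X e).
  by apply: (cotorsion_l_iso cotUX _ UU); apply: isomorphic_sym; exists v.
have [e2 [Y' [a2 [b2 [a2' [b2' [see2 YY Me2]]]]]]] := quad_complete_l Ue.
have [f [f' [sef _ _]]] := quad_short_exact_linear see.
have [g [g' [seg _ _]]] := quad_short_exact_linear see2.
(* The kernel of the composite epimorphism is an extension of H X1 by Z Y', both in the right
   class. *)
have [gf [f3 [g3 [se3 _]]]] := short_exact_ker_comp sef seg.
exists (Ker (f' \o g' : {linear _ -> _})), (quad_module e2), (val : {linear _ -> _}),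
  (f' \o g' : {linear _ -> _}); split=> //; last exact: short_exact_Ker.
apply: (cotorsion_r_extension cotorsion_class_M_class_N se3).
  exact: class_N_Z.
exact: class_N_H.
Qed.

Lemma class_complete : complete_pair classM classN.
Proof.
move=> L; have [q Lq] := quad_of L; split.
  have [D1 [C1 [i [p [CM DN se]]]]] := class_complete_l q.
  have [i' [p' se']] := short_exact_isomorphic
    (isomorphic_refl D1) (isomorphic_refl C1) (isomorphic_sym Lq) se.
  by exists D1, C1, i', p'.
have [D2 [C2 [i [p [CM DN se]]]]] := class_complete_r q.
have [i' [p' se']] := short_exact_isomorphic
  (isomorphic_sym Lq) (isomorphic_refl D2) (isomorphic_refl C2) se.
by exists D2, C2, i', p'.
Qed.
End MoritaCotorsion.

Theorem corollary4p8 (A B : pzRingType) (c : morita_context A B)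
    (U X : lmodType A -> Prop) (V Y : lmodType B -> Prop)
    (cotUX : cotorsion_pair U X) (cotVY : cotorsion_pair V Y)
    (MN0 : forall t : tensor (mctx_M c) (mctx_N c), t = 0) :
  ((forall W : lmodType A, U W -> Tor1_eq0 (mctx_M c) W) ->
     cotorsion_pair (left_perp (class_N c X Y)) (class_N c X Y)) /\
  ((forall W : lmodType A, X W -> Ext1_eq0 (mctx_N c) W) ->
     cotorsion_pair (class_M c U V) (right_perp (class_M c U V))) /\
  ((forall W : lmodType A, U W -> Tor1_eq0 (mctx_M c) W) ->
   (forall W : lmodType A, X W -> Ext1_eq0 (mctx_N c) W) ->
     cotorsion_pair (class_M c U V) (class_N c X Y) /\
     (complete_pair U X /\ hereditary_pair U X ->
      complete_pair V Y /\ hereditary_pair V Y ->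
      complete_pair (class_M c U V) (class_N c X Y) /\
      hereditary_pair (class_M c U V) (class_N c X Y))).
Proof.
split; first by move=> torU; exact: (cotorsion_perp_class_N cotUX cotVY MN0 torU).
split; first by move=> extX; exact: (cotorsion_class_M_perp cotUX cotVY MN0 extX).
move=> torU extX; split; first exact: (cotorsion_class_M_class_N cotUX cotVY MN0 torU extX).
move=> [cUX hUX] [cVY hVY]; split.
  exact: (class_complete cotUX cotVY MN0 torU extX cUX cVY).
exact: (class_hereditary cotUX cotVY torU extX hUX hVY).
Qed.
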